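(* Let $\mathcal H$ and $\mathcal K$ be separable Hilbert spaces, let $A$ be a bounded self-adjoint operator on $\mathcal H$, let $\mathbf B:\mathcal K\to\mathcal H$ be a bounded operator with $\operatorname{Ker}\mathbf B=\{\mathbf 0\}$, and let $\Gamma=\Gamma^*\ge\mathbf 0$ be a bounded invertible operator on $\mathcal K$. For $t\in\mathbb R$ put $A_t=A+t\,\mathbf B\Gamma\mathbf B^*$ and let $\mathbf E_t$ be the projection-valued spectral measure of $A_t$. Then $$\int_{\mathbb R}\mathbf B^*\mathbf E_t\mathbf B\,\mathrm dt=\Gamma^{-1}\otimes\mathfrak L,$$ where $\mathfrak L$ is the Lebesgue (Borel) measure on $\mathbb R$, meaning that for any Borel set $E\subset\mathbb R$ $$\int_{\mathbb R}\mathbf B^*\mathbf E_t(E)\mathbf B\,\mathrm dt=\mathfrak L(E)\,\Gamma^{-1},$$ the last integral being understood in the weak sense.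
   Context: ''Invertible'' means boundedly invertible. The weak sense of the last identity: for every $\mathbf x\in\mathcal K$, $\int_{\mathbb R}\langle\mathbf B^*\mathbf E_t(E)\mathbf B\mathbf x,\mathbf x\rangle\,\mathrm dt=\mathfrak L(E)\langle\Gamma^{-1}\mathbf x,\mathbf x\rangle$ as an identity in $[0,\infty]$ (with $\infty\cdot 0=0$); when $\mathfrak L(E)<\infty$ this is equivalent, by polarization, to $\int_{\mathbb R}\langle\mathbf B^*\mathbf E_t(E)\mathbf B\mathbf x,\mathbf y\rangle\,\mathrm dt=\mathfrak L(E)\langle\Gamma^{-1}\mathbf x,\mathbf y\rangle$ for all $\mathbf x,\mathbf y\in\mathcal K$. Cyclicity of $\operatorname{Ran}\mathbf B$ for $A$ is not assumed. *)

(* Defs.v *)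
From HB Require Import structures.
From mathcomp Require Import all_boot all_order all_algebra.
From mathcomp Require Import all_classical all_reals all_analysis.
From mathcomp Require Import complex.

Set Implicit Arguments.
Unset Strict Implicit.
Unset Printing Implicit Defensive.

Import Order.TTheory GRing.Theory Num.Theory.
Import numFieldNormedType.Exports.

Local Open Scope classical_set_scope.
Local Open Scope complex_scope.
Local Open Scope ring_scope.

(* The inner product is linear in its first argument and conjugate-linear in
   its second one. *)
HB.mixin Record NormedModule_isHilbert (R : realType) (H : Type)
    & CompleteNormedModule R[i] H := {
  inner : {dot H for (@Num.conj R[i])};
  inner_norm : forall x : H, `|x| ^+ 2 = inner x x
}.

#[short(type="hilbertType")]
HB.structure Definition Hilbert (R : realType) :=
  {H of CompleteNormedModule R[i] H & NormedModule_isHilbert R H}.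

Notation "''[' x , y ]" := (inner x y) : ring_scope.

Definition separable (T : topologicalType) : Prop :=
  exists2 D : set T, countable D & dense D.

Definition bounded_op (R : realType) (U V : hilbertType R) (f : U -> V) : Prop :=
  exists M : R, forall x, `|f x| <= M%:C * `|x|.

Definition is_adjoint (R : realType) (U V : hilbertType R)
    (f : U -> V) (g : V -> U) : Prop :=
  forall x y, '[f x, y] = '[x, g y].

(* A bounded linear operator has exactly one adjoint (Riesz), so that the
   default value is irrelevant for such operators. *)
Definition adjoint (R : realType) (U V : hilbertType R) (f : U -> V) : V -> U :=
  xget (fun=> 0) [set g | is_adjoint f g].

Definition selfadjoint (R : realType) (U : hilbertType R) (f : U -> U) : Prop :=
  is_adjoint f f.

(* The order of R[i] is such that 0 <= z means that z is real and
   nonnegative. *)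
Definition nonnegative_op (R : realType) (U : hilbertType R) (f : U -> U) : Prop :=
  forall x, 0 <= '[f x, x].

Definition is_inverse (U V : Type) (f : U -> V) (g : V -> U) : Prop :=
  cancel f g /\ cancel g f.

Definition boundedly_invertible (R : realType) (U V : hilbertType R)
    (f : U -> V) : Prop :=
  exists2 g : V -> U, is_inverse f g & bounded_op g.

(* The default value is irrelevant as soon as f is invertible. *)
Definition inverse (R : realType) (U V : hilbertType R) (f : U -> V) : V -> U :=
  xget (fun=> 0) [set g | is_inverse f g].

Definition orthogonal_projection (R : realType) (U : hilbertType R)
    (P : U -> U) : Prop :=
  (forall x, P (P x) = P x) /\ selfadjoint P.

(* Projection-valued measures on the Borel subsets of the real line; E is only
   constrained on measurable sets.  Countable additivity is in the strong
   operator topology. *)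
Record projection_valued_measure (R : realType) (U : hilbertType R)
    (E : set R -> {linear U -> U}) : Prop := {
  pvm_proj : forall S, measurable S -> orthogonal_projection (E S);
  pvm_set0 : forall x, E set0 x = 0;
  pvm_setT : forall x, E setT x = x;
  pvm_setI : forall S T, measurable S -> measurable T ->
    forall x, E (S `&` T) x = E S (E T x);
  pvm_sigma_additive : forall F : (set R)^nat,
    (forall n, measurable (F n)) -> trivIset setT F ->
    forall x, (\sum_(0 <= k < n) E (F k) x) @[n --> \oo]
                --> E (\bigcup_n F n) x
}.

(* E is the spectral measure of the bounded operator A: E is a
   projection-valued measure, it has bounded support, and A is the integral of
   l dE(l) in the weak sense.  For the latter, mu is the scalar measure
   S |-> '[E S x, x] (a nonnegative real since E S is a projection), and the
   diagonal '[A x, x] suffices by polarization, the scalars being complex. *)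
Definition spectral_measure (R : realType) (U : hilbertType R)
    (A : U -> U) (E : set R -> {linear U -> U}) : Prop :=
  [/\ projection_valued_measure E,
      exists M : R, forall x, E `[- M, M]%classic x = x
    & forall x, exists mu : {measure set R -> \bar R},
        (forall S, measurable S -> mu S = (complex.Re '[E S x, x])%:E) /\
        '[A x, x] = (\int[mu]_(l in setT) l)%:C ].

Definition perturbation (R : realType) (H K : hilbertType R)
    (A : H -> H) (B : K -> H) (Gamma : K -> K) (t : R) : H -> H :=
  fun x => A x + t%:C *: B (Gamma (adjoint B x)).

(* Main.v *)
(* For Im z > 0 put V = B Gamma B^*, b = B x and Phi(t) = <(A + t V - z)^-1 b, b>.
   The function Phi extends holomorphically and boundedly to the lower
   half-plane Im t <= 0, so the Poisson formula of that half-plane gives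
     int Im Phi(t) tau^2 / (t^2 + tau^2) dt = pi tau Im Phi(- i tau).
   Since B is injective, tau Im Phi(- i tau) tends to <Gamma^-1 x, x> as tau
   tends to infinity, and by monotone convergence
     int Im Phi(t) dt = pi <Gamma^-1 x, x>   for every z.
   By the spectral theorem Im Phi(t) is the Poisson integral at z of the scalar
   spectral measure of A + t V at b; Stieltjes inversion, dominated
   convergence and the uniqueness of Lebesgue measure turn the last identity
   into the theorem. *)
From HB Require Import structures.
Require Import Defs.
From mathcomp Require Import all_boot all_order all_algebra.
From mathcomp Require Import all_classical all_reals all_analysis.
From mathcomp Require Import measurable_realfun complex ring lra.

Set Implicit Arguments.
Unset Strict Implicit.
Unset Printing Implicit Defensive.

Import Order.TTheory GRing.Theory Num.Theory.
Import numFieldNormedType.Exports.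

Local Open Scope classical_set_scope.
Local Open Scope complex_scope.
Local Open Scope ring_scope.

(** * Real inner products and orthogonal projection *)

(** The half-plane [Im t <= 0] is singled out by the sign of [V]: there the imaginary part of
    [A + t V - z] is at most [- Im z], so the resolvent exists with norm at most [(Im z)^-1],
    uniformly in [t]. Contour integration is replaced by real calculus: Taylor estimates with a
    uniform quadratic remainder let a segment be moved down in small steps, each of which changes
    the integral by a boundary term up to a quadratic error. A spectral measure is only
    characterized by the form of its operator, the first moment. The formula for the resolvent is
    derived from this: on the spectral subspace of a short interval the operator is nearly a scalar,
    and the errors vanish under refinement. At [t = - i tau] the vector [t Gamma B^* r], where [r]
    is the resolvent applied to [B x], should approach [x]. The difference is small only after
    applying [B], hence only against vectors of the range of [B^*]; injectivity of [B] makes this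
    range dense. Measurability of the spectral measures in [t] is not assumed: it is recovered from
    that of their Poisson integrals. *)

Lemma conjCE (R : rcfType) (z : R[i]) : Num.conj z = z^*%C.
Proof.
have [->|z0] := eqVneq z 0; first by rewrite conjC0 conjc0.
by apply: (mulfI z0); rewrite -normCK sqr_normc.
Qed.

Section RealInnerProduct.
Context {R : realType} {H : hilbertType R}.
Implicit Types (x y z : H) (a : R).

(** Estimates are made with the underlying real inner product. Nothing is lost: the imaginary part
    of the complex one is recovered by testing against ['i *: y] ([Im_inner]). *)
Definition rdot x y : R := complex.Re '[x, y].
Definition rnorm x : R := complex.Re `|x|.

Lemma rnormE x : `|x| = (rnorm x)%:C.
Proof.
by rewrite /rnorm RRe_real.
Qed.

Lemma rnorm_ge0 x : 0 <= rnorm x.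
Proof. by have := normr_ge0 x; rewrite rnormE ler0c. Qed.

Lemma rdotxx x : rdot x x = rnorm x ^+ 2.
Proof. by rewrite /rdot -inner_norm rnormE -rmorphXn. Qed.

Lemma innerC x y : '[x, y] = ('[y, x])^*.
Proof.
rewrite hermC expr0 mul1r /=; exact: conjCE.
Qed.

Lemma innerZl (c : R[i]) x y : '[c *: x, y] = c * '[x, y].
Proof. by rewrite linearZl_LR. Qed.

Lemma innerZr (c : R[i]) x y : '[x, c *: y] = c^*%C * '[x, y].
Proof. by rewrite linearZr_LR /= conjCE. Qed.

Lemma rdotC x y : rdot x y = rdot y x.
Proof. by rewrite /rdot innerC; case: ('[y, x]). Qed.

Lemma rdotDl x y z : rdot (x + y) z = rdot x z + rdot y z.
Proof. by rewrite /rdot linearDl raddfD. Qed.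

Lemma rdotDr x y z : rdot z (x + y) = rdot z x + rdot z y.
Proof. by rewrite /rdot linearDr raddfD. Qed.

Lemma rdotNl x z : rdot (- x) z = - rdot x z.
Proof. by rewrite /rdot linearNl raddfN. Qed.

Lemma rdotNr x z : rdot z (- x) = - rdot z x.
Proof. by rewrite /rdot linearNr raddfN. Qed.

Lemma rdotBl x y z : rdot (x - y) z = rdot x z - rdot y z.
Proof. by rewrite rdotDl rdotNl. Qed.

Lemma rdotBr x y z : rdot z (x - y) = rdot z x - rdot z y.
Proof. by rewrite rdotDr rdotNr. Qed.

Lemma rdot0l z : rdot 0 z = 0.
Proof. by rewrite /rdot linear0l. Qed.

Lemma rdot0r z : rdot z 0 = 0.
Proof. by rewrite rdotC rdot0l. Qed.

Lemma rdotZl a x y : rdot (a%:C *: x) y = a * rdot x y.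
Proof.
rewrite /rdot linearZl_LR /=.
by case: ('[x, y]) => u v /=; rewrite mul0r subr0.
Qed.

Lemma rdotZr a x y : rdot x (a%:C *: y) = a * rdot x y.
Proof. by rewrite rdotC rdotZl rdotC. Qed.

Lemma Im_inner x y : complex.Im '[x, y] = rdot x ('i *: y).
Proof.
rewrite /rdot linearZr_LR /=.
by case: ('[x, y]) => u v /=; simpc.
Qed.

Lemma rdot_ext x y : (forall z, rdot x z = rdot y z) -> x = y.
Proof.
move=> h; apply/eqP; rewrite -subr_eq0; apply/eqP.
have : rdot (x - y) (x - y) = 0 by rewrite rdotBl h subrr.
rewrite rdotxx => /eqP; rewrite expf_eq0 /= => /eqP h0.
by apply/eqP; rewrite -normr_eq0 rnormE h0.
Qed.

Lemma inner_ext x y : (forall z, '[x, z] = '[y, z]) -> x = y.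
Proof. by move=> h; apply: rdot_ext => z; rewrite /rdot h. Qed.

Lemma rnorm0 : rnorm 0 = 0.
Proof. by rewrite /rnorm normr0. Qed.

Lemma rnorm_eq0 x : rnorm x = 0 -> x = 0.
Proof. by move=> h; apply/eqP; rewrite -normr_eq0 rnormE h. Qed.

Lemma rnormD x y : rnorm (x + y) <= rnorm x + rnorm y.
Proof. by have := ler_normD x y; rewrite !rnormE -rmorphD lecR. Qed.

Lemma rnormN x : rnorm (- x) = rnorm x.
Proof. by rewrite /rnorm normrN. Qed.

Lemma rnorm_distC x y : rnorm (x - y) = rnorm (y - x).
Proof. by rewrite -rnormN opprB. Qed.

Lemma rnorm_triangle z x y : rnorm (x - y) <= rnorm (x - z) + rnorm (z - y).
Proof. by rewrite -{1}(subrK z x) -addrA rnormD. Qed.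

Lemma rnormZr (c : R[i]) x : rnorm (c *: x) = complex.Re `|c| * rnorm x.
Proof.
rewrite {1}/rnorm normrZ rnormE.
by case: `|c| => u v /=; rewrite mulr0 subr0.
Qed.

Lemma rnormZ a x : rnorm (a%:C *: x) = `|a| * rnorm x.
Proof. by rewrite rnormZr normc_def /= expr0n /= addr0 sqrtr_sqr. Qed.

Lemma rnormZi x : rnorm ('i *: x) = rnorm x.
Proof. by rewrite rnormZr normc_def /= expr0n /= expr1n add0r sqrtr1 mul1r. Qed.

Lemma rnormD_sq x y :
  rnorm (x + y) ^+ 2 = rnorm x ^+ 2 + 2 * rdot x y + rnorm y ^+ 2.
Proof. by rewrite -!rdotxx rdotDl !rdotDr (rdotC y x); ring. Qed.

Lemma rnormB_sq x y :
  rnorm (x - y) ^+ 2 = rnorm x ^+ 2 - 2 * rdot x y + rnorm y ^+ 2.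
Proof. by rewrite rnormD_sq rdotNr rnormN; ring. Qed.

(** The triangle inequality of the given norm, once squared, is already the Cauchy-Schwarz
    inequality. *)
Lemma rdot_le x y : rdot x y <= rnorm x * rnorm y.
Proof.
have := rnormD x y; have := rnorm_ge0 (x + y); have := rnormD_sq x y.
have := rnorm_ge0 x; have := rnorm_ge0 y; nra.
Qed.

Lemma norm_rdot_le x y : `|rdot x y| <= rnorm x * rnorm y.
Proof.
rewrite ler_norml rdot_le andbT lerNl -rdotNl.
by apply: le_trans (rdot_le _ _) _; rewrite rnormN.
Qed.

Lemma norm_inner_le x y : complex.Re `|'[x, y]| <= rnorm x * rnorm y.
Proof.
set w := '[x, y]; set r := complex.Re `|w|.
have r0 : 0 <= r by have := normr_ge0 w; rewrite lecE => /andP[].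
have rE : `|w| = r%:C by rewrite /r RRe_real.
(* Multiplying [x] by the conjugate of [w] makes the inner product real, so the real Cauchy-Schwarz
   inequality applies without loss. *)
have : rdot (w^*%C *: x) y = r ^+ 2.
  by rewrite /rdot linearZl_LR /= -/w mulrC -sqr_normc rE -rmorphXn.
have := rdot_le (w^*%C *: x) y; rewrite rnormZr normcJ -/r => h e.
have [->|rn] := eqVneq r 0; first by rewrite mulr_ge0 ?rnorm_ge0.
have rp : 0 < r by rewrite lt_def rn.
by rewrite -(ler_pM2l rp) mulrA -expr2 -e.
Qed.

Lemma rnorm_dual x M : 0 <= M ->
  (forall y, rdot x y <= M * rnorm y) -> rnorm x <= M.
Proof.
move=> M0 /(_ x); rewrite rdotxx expr2.
have [->|x0] := eqVneq (rnorm x) 0; first by [].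
by rewrite ler_pM2r// lt_def x0 rnorm_ge0.
Qed.

Definition hcvg (u : nat -> H) (l : H) :=
  forall e : R, 0 < e -> exists N, forall n, (N <= n)%N -> rnorm (u n - l) <= e.

Definition hcauchy (u : nat -> H) :=
  forall e : R, 0 < e -> exists N, forall n m, (N <= n)%N -> (N <= m)%N ->
    rnorm (u n - u m) <= e.

Lemma complex_gt0 (e : R[i]) : 0 < e -> exists2 r : R, 0 < r & e = r%:C.
Proof.
move=> e0; have er := gtr0_real e0; exists (complex.Re e).
  by move: e0; rewrite -{1}(RRe_real er) ltcR.
by rewrite RRe_real.
Qed.

Lemma hcauchy_cvg (u : nat -> H) : hcauchy u -> exists l, hcvg u l.
Proof.
move=> uc.
have cu : cvg (u @ \oo).
  apply/cauchy_cvgP/cauchy_ballP => _ /complex_gt0[e e0 ->].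
  have [N uN] := uc (e / 2) (divr_gt0 e0 (ltr0n _ 2)).
  pose A := [set x | exists2 n, (N <= n)%N & x = u n].
  exists (A, A); first by split; exists N => // n Nn; exists n.
  move=> [x y] [/= [n Nn ->] [m Nm ->]].
  rewrite -ball_normE /= rnormE ltcR; apply: le_lt_trans (uN n m Nn Nm) _.
  by rewrite ltr_pdivrMr// ltr_pMr// ltr1n.
exists (lim (u @ \oo)) => e e0.
have /cvgrPdist_lt/(_ e%:C) := cu.
rewrite ltcR => /(_ e0)[N _ uN]; exists N => n Nn.
by have := uN n Nn; rewrite /= rnormE ltcR rnorm_distC => /ltW.
Qed.

End RealInnerProduct.

Section Projection.
Context {R : realType} {H : hilbertType R}.

Lemma le_of_eps (a b : R) : (forall e : R, 0 < e -> a <= b + e) -> a <= b.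
Proof. by move=> h; apply/ler_addgt0Pr. Qed.

Lemma archi_inv (e : R) : 0 < e -> exists N : nat, forall n, (N <= n)%N ->
  n.+1%:R^-1 <= e.
Proof.
move=> e0; have [N _ hN] := near_infty_natSinv_lt (PosNum e0).
by exists N => n Nn; exact/ltW/hN.
Qed.

(* The foot [p] of the perpendicular lies in the closure of [M]; no
   completeness of [M] is required. *)
Lemma orthogonal_foot (M : set H) (b : H) :
  M 0 -> (forall x y, M x -> M y -> M (x + y)) ->
  (forall (c : R[i]) x, M x -> M (c *: x)) ->
  exists2 p, (exists2 m : nat -> H, (forall n, M (m n)) & hcvg m p) &
    forall x, M x -> '[b - p, x] = 0.
Proof.
move=> M0 MD MZ.
pose D := [set rnorm (b - m) | m in M].
have infD : has_inf D.
  by split; [exists (rnorm (b - 0)), 0|exists 0 => _ [m _ <-]; exact: rnorm_ge0].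
pose d := inf D.
have dle m : M m -> d <= rnorm (b - m).
  by move=> Mm; apply: ge_inf; [exact: infD.2|exists m].
have d0 : 0 <= d by apply: lb_le_inf; [exact: infD.1|move=> _ [m _ <-]; exact: rnorm_ge0].
have hm n : exists m, M m /\ rnorm (b - m) <= d + n.+1%:R^-1.
  have [|_ [m Mm <-] dm] := @inf_adherent R D n.+1%:R^-1 _ infD.
    by rewrite invr_gt0.
  by exists m; split => //; exact: ltW.
have [m mP] := choice hm.
have Mm n : M (m n) by have [] := mP n.
have md n : rnorm (b - m n) <= d + n.+1%:R^-1 by have [] := mP n.
have mc : hcauchy m.
  move=> e e0.
  (* By the parallelogram law the squared distance of two [g]-minimizers is at most
     [4 (d + g)^2 - 4 d^2 = 8 d g + 4 g^2], which is at most [g (8 d + 4)] as [g <= 1]. *)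
  pose g := Num.min 1 (e ^+ 2 / (8 * d + 4)).
  have den : 0 < 8 * d + 4 by lra.
  have g0 : 0 < g by rewrite lt_min ltr01 /= divr_gt0// exprn_gt0.
  have [N hN] := archi_inv g0; exists N => n k Nn Nk.
  have an : rnorm (b - m n) <= d + g.
    by apply: le_trans (md n) _; rewrite lerD2l hN.
  have ak : rnorm (b - m k) <= d + g.
    by apply: le_trans (md k) _; rewrite lerD2l hN.
  have hs : 2 * d <= rnorm ((b - m n) + (b - m k)).
    have -> : (b - m n) + (b - m k) =
        (2 : R)%:C *: (b - (2^-1 : R)%:C *: (m n + m k)).
      rewrite scalerBr scalerA -rmorphM divff ?pnatr_eq0// scale1r.
      by rewrite -[2]/(1 + 1 : R) rmorphD scalerDl scale1r opprD addrACA.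
    rewrite rnormZ ger0_norm// ler_pM2l//; apply: dle; apply: MZ; exact: MD.
  have e1 := rnormD_sq (b - m n) (b - m k).
  have e2 := rnormB_sq (b - m n) (b - m k).
  have e3 : (b - m n) - (b - m k) = m k - m n.
    by rewrite opprB addrC addrA subrK.
  rewrite e3 in e2.
  have g1 : g <= 1 by rewrite ge_min lexx.
  have g2 : g * (8 * d + 4) <= e ^+ 2.
    by rewrite -ler_pdivlMr// ge_min lexx orbT.
  have hn0 := rnorm_ge0 (b - m n); have hk0 := rnorm_ge0 (b - m k).
  have an2 : rnorm (b - m n) ^+ 2 <= (d + g) ^+ 2 by rewrite ler_sqr ?nnegrE//; lra.
  have ak2 : rnorm (b - m k) ^+ 2 <= (d + g) ^+ 2 by rewrite ler_sqr ?nnegrE//; lra.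
  have hs2 : (2 * d) ^+ 2 <= rnorm (b - m n + (b - m k)) ^+ 2.
    by rewrite ler_sqr ?nnegrE ?rnorm_ge0//; lra.
  rewrite rnorm_distC -ler_sqr ?nnegrE ?rnorm_ge0//; last exact: ltW.
  nra.
have [p mp] := hcauchy_cvg mc.
exists p; first by exists m.
have pd : rnorm (b - p) <= d.
  apply: le_of_eps => e e0.
  have e20 : 0 < e / 2 by lra.
  have [N1 h1] := archi_inv e20; have [N2 h2] := mp _ e20.
  pose n := maxn N1 N2.
  have := rnorm_triangle (m n) b p.
  have := md n; have := h1 n (leq_maxl _ _); have := h2 n (leq_maxr _ _).
  set i := n.+1%:R^-1; move: i => i; lra.
have dp x : M x -> d <= rnorm (b - p - x).
  move=> Mx; apply: le_of_eps => e e0.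
  have [N2 h2] := mp _ e0.
  have := h2 N2 (leqnn _).
  have := dle _ (MD _ _ (Mm N2) Mx).
  have -> : b - (m N2 + x) = (b - p - x) + (p - m N2).
    by rewrite [RHS]addrACA subrK opprD (addrC (- x)).
  have := rnormD (b - p - x) (p - m N2).
  rewrite (rnorm_distC p); lra.
have rx x : M x -> rdot (b - p) x = 0.
  move=> Mx.
  have [x0|x0] := eqVneq (rnorm x) 0; first by rewrite (rnorm_eq0 x0) rdot0r.
  (* The optimal coefficient: subtracting [s x] lowers the squared distance by exactly [s^2] times
     the squared norm of [x], which minimality of [p] forces to be zero. *)
  pose s := rdot (b - p) x / rnorm x ^+ 2.
  have hx : 0 < rnorm x ^+ 2 by rewrite exprn_gt0// lt_def x0 rnorm_ge0.
  have sE : s * rnorm x ^+ 2 = rdot (b - p) x by rewrite divfK// gt_eqF.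
  have h := le_trans pd (dp _ (MZ s%:C _ Mx)).
  have h2 : rnorm (b - p) ^+ 2 <= rnorm (b - p - s%:C *: x) ^+ 2.
    by rewrite ler_sqr ?nnegrE ?rnorm_ge0.
  move: h2; rewrite (rnormB_sq (b - p)) rdotZr rnormZ exprMn real_normK ?num_real// -sE.
  set X := rnorm x ^+ 2 in hx *; set Y := rnorm (b - p) ^+ 2 => h2.
  have sX : s ^+ 2 * X <= 0.
    have -> : s ^+ 2 * X = Y - (Y - 2 * (s * (s * X)) + s ^+ 2 * X) by ring.
    by rewrite subr_le0.
  have : s ^+ 2 <= 0 by rewrite -(ler_pM2r hx) mul0r.
  by rewrite real_exprn_even_le0 ?num_real//= => /eqP ->; rewrite mul0r.
move=> x Mx; have h1 := rx x Mx; have h2 := rx _ (MZ 'i x Mx).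
move: h1 h2; rewrite -Im_inner /rdot; case: ('[_, _]) => u v /= -> ->; exact: erefl.
Qed.

End Projection.

(** * Bounded operators, adjoints and coercivity *)

Lemma bounded_opP (R : realType) (U V : hilbertType R) (f : U -> V) :
  bounded_op f -> exists2 M : R, 0 < M & forall x, rnorm (f x) <= M * rnorm x.
Proof.
move=> [M fM]; exists (Num.max M 1); first by rewrite lt_max ltr01 orbT.
move=> x; have := fM x; rewrite !rnormE -rmorphM lecR => /le_trans; apply.
by rewrite ler_wpM2r ?rnorm_ge0// le_max lexx.
Qed.

Lemma hcvg_inner (R : realType) (U : hilbertType R) (u : nat -> U) l (y : U)
    (c : R[i]) :
  hcvg u l -> (forall n, '[u n, y] = c) -> '[l, y] = c.
Proof.
move=> ul uc; apply/eqP; rewrite -subr_eq0 -normr_eq0; apply/eqP.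
have -> : `|'[l, y] - c| = (complex.Re `|'[l, y] - c|)%:C by rewrite RRe_real.
rewrite (_ : complex.Re _ = 0)//; apply/eqP; rewrite eq_le; apply/andP; split.
  apply: le_of_eps => e e0; rewrite add0r.
  have y0 := rnorm_ge0 y.
  have yp : 0 < rnorm y + 1 by lra.
  have [N hN] := ul _ (divr_gt0 e0 yp).
  rewrite -(uc N) -linearBl; apply: le_trans (norm_inner_le _ _) _.
  rewrite rnorm_distC; apply: le_trans (ler_wpM2r y0 (hN N (leqnn _))) _.
  by rewrite mulrAC ler_pdivrMr// ler_pM2l// lerDl.
by have := normr_ge0 ('[l, y] - c); rewrite lecE => /andP[].
Qed.

Lemma hcvg_bounded (R : realType) (U V : hilbertType R) (f : {linear U -> V})
    (u : nat -> U) l : bounded_op f -> hcvg u l -> hcvg (f \o u) (f l).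
Proof.
move=> /bounded_opP[M M0 fM] ul e e0; have [N hN] := ul _ (divr_gt0 e0 M0).
exists N => n Nn /=; rewrite -linearB; apply: le_trans (fM _) _.
by rewrite -ler_pdivlMl// mulrC; exact: hN.
Qed.

Lemma hcvg_unique (R : realType) (U : hilbertType R) (u : nat -> U) l l' :
  hcvg u l -> hcvg u l' -> l = l'.
Proof.
move=> ul ul'; apply/eqP; rewrite -subr_eq0; apply/eqP/rnorm_eq0/eqP.
rewrite eq_le rnorm_ge0 andbT; apply: le_of_eps => e e0; rewrite add0r.
have e20 : 0 < e / 2 by lra.
have [N hN] := ul _ e20; have [N' hN'] := ul' _ e20.
have := rnorm_triangle (u (maxn N N')) l l'; rewrite (rnorm_distC l (u _)).
have := hN _ (leq_maxl N N'); have := hN' _ (leq_maxr N N').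
lra.
Qed.

Section Adjoint.
Context {R : realType} {U V : hilbertType R}.
Variables (f : {linear U -> V}) (f_bounded : bounded_op f).

(** The functional in question has kernel [M]. The part [e] of a vector outside [M] that is
    orthogonal to [M] spans a complement: every [x] differs from a multiple of [e] by an element of
    [M]. *)
Lemma riesz_representation (y : V) : exists w : U, forall x, '[f x, y] = '[x, w].
Proof.
have [h|/existsNP[x0 /eqP fx0]] := pselect (forall x, '[f x, y] = 0).
  by exists 0 => x; rewrite h linear0r.
pose M := [set x | '[f x, y] = 0].
have [|x z|c x|p [m Mm mp] ort] := @orthogonal_foot _ _ M x0.
- by rewrite /M /= linear0 linear0l.
- by rewrite /M /= linearD linearDl /= => -> ->; rewrite addr0.
- by rewrite /M /= linearZ linearZl_LR /= => -> /=; rewrite mulr0.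
(* Boundedness of [f] makes [M] closed, so the foot [p] stays in [M] and [e] below does not lie in
   it. *)
have fp : '[f p, y] = 0 by apply: hcvg_inner (hcvg_bounded f_bounded mp) _.
pose e := x0 - p.
have fe : '[f e, y] != 0 by rewrite /e linearB linearBl /= fp subr0.
have ee : '[e, e] != 0.
  apply: contraNneq fe => h; rewrite (_ : e = 0) ?linear0 ?linear0l//.
  by apply/eqP; rewrite -normr_eq0 -sqrf_eq0 inner_norm h.
exists (('[f e, y] / '[e, e])^*%C *: e) => x.
pose c := '[f x, y] / '[f e, y].
have : '[e, x - c *: e] = 0.
  apply: ort; rewrite /M /= linearB linearZ linearBl linearZl_LR /=.
  by rewrite divfK// subrr.
rewrite innerC => /eqP; rewrite conjc_eq0 linearBl linearZl_LR /= subr_eq0 => /eqP xe.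
rewrite linearZr_LR /= conjCE conjcK xe /c.
by field; rewrite fe ee.
Qed.

Lemma adjointP : is_adjoint f (adjoint f).
Proof.
have [g gP] := choice riesz_representation.
by have : is_adjoint f (xget (fun=> 0) [set g | is_adjoint f g]) by apply: (xgetPex _); exists g => x y.
Qed.

Lemma rdot_adjoint x y : rdot (f x) y = rdot x (adjoint f y).
Proof. by rewrite /rdot adjointP. Qed.

Lemma inner_adjointl x y : '[adjoint f y, x] = '[y, f x].
Proof. by rewrite innerC -adjointP [RHS]innerC. Qed.

Lemma adjoint_is_linear : linear (adjoint f).
Proof.
move=> c x y; apply: inner_ext => z.
by rewrite linearDl linearZl_LR /= !inner_adjointl linearDl linearZl_LR.
Qed.

Lemma adjoint_bounded : bounded_op (adjoint f).
Proof.
have [M M0 fM] := bounded_opP f_bounded.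
exists M => y; rewrite !rnormE -rmorphM lecR.
apply: rnorm_dual => [|x]; first by rewrite mulr_ge0 ?rnorm_ge0 ?ltW.
rewrite rdotC -rdot_adjoint; apply: le_trans (rdot_le _ _) _.
by rewrite -mulrA (mulrC (rnorm y)) mulrA ler_wpM2r ?rnorm_ge0.
Qed.

(* The range of [adjoint f] is dense when [f] is injective: it has no nonzero
   orthogonal vector. *)
Lemma adjoint_dense : (forall x, f x = 0 -> x = 0) ->
  forall (w : U) (e : R), 0 < e -> exists y, rnorm (w - adjoint f y) <= e.
Proof.
move=> f0 w.
pose M := range (adjoint f).
have lin := adjoint_is_linear.
have [|x z [x' _ <-] [z' _ <-]|c x [x' _ <-]|p [m Mm mp] ort] := @orthogonal_foot _ _ M w.
- exists 0 => //; have := lin (-1) 0 0.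
  by rewrite scaler0 addr0 scaleN1r addNr.
- by exists (x' + z') => //; have := lin 1 x' z'; rewrite !scale1r.
- exists (c *: x') => //; have := lin c x' 0; rewrite addr0 => ->.
  have := lin (-1) 0 0; rewrite scaler0 addr0 scaleN1r addNr => ->.
  by rewrite addr0.
have wp : w = p.
  apply/eqP; rewrite -subr_eq0; apply/eqP/f0/inner_ext => z.
  by rewrite adjointP linear0l; apply: ort; exists z.
move=> e e0; have [N hN] := mp _ e0.
have [y _ yE] := Mm N; exists y.
by rewrite wp yE rnorm_distC; exact: hN.
Qed.

End Adjoint.

(* The range of [T] is complete by coercivity, hence equal to its closure, and
   the foot of the perpendicular from [b] to it is [b]. *)
Lemma coercive_surjective (R : realType) (H : hilbertType R)
    (T : {linear H -> H}) (c : R) : bounded_op T -> 0 < c ->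
  (forall x, c * rnorm x ^+ 2 <= complex.Im '[x, T x]) ->
  forall b, exists x, T x = b.
Proof.
move=> T_bounded c0 Tc b.
have Tn x : c * rnorm x <= rnorm (T x).
  have [->|x0] := eqVneq (rnorm x) 0; first by rewrite mulr0 rnorm_ge0.
  have xp : 0 < rnorm x by rewrite lt_def x0 rnorm_ge0.
  have := le_trans (Tc x) (_ : _ <= rnorm x * rnorm (T x)).
  rewrite expr2 mulrA (mulrC (rnorm x)) ler_pM2r//; apply.
  by rewrite Im_inner; apply: le_trans (rdot_le _ _) _; rewrite rnormZi mulrC.
have [|x z [x' _ <-] [z' _ <-]|d x [x' _ <-]|p [m Mm mp] ort] := @orthogonal_foot _ _ (range T) b.
- by exists 0; rewrite ?linear0.
- by exists (x' + z'); rewrite ?linearD.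
- by exists (d *: x'); rewrite ?linearZ.
have hr n : exists x, T x = m n by have [x _ xm] := Mm n; exists x.
have [r rm] := choice hr.
have rc : hcauchy r.
  move=> e e0.
  have ce : 0 < c * e / 2 by rewrite divr_gt0// mulr_gt0.
  have [N hN] := mp _ ce; exists N => n k Nn Nk.
  rewrite -(ler_pM2l c0); apply: le_trans (Tn _) _.
  rewrite linearB /= !rm.
  have := rnorm_triangle p (m n) (m k); rewrite (rnorm_distC p).
  have := hN n Nn; have := hN k Nk; lra.
have [l rl] := hcauchy_cvg rc.
have Tl : T l = p.
  apply: hcvg_unique mp; rewrite (_ : m = T \o r); last by apply/funext => n /=; rewrite rm.
  exact: hcvg_bounded.
(* The vector [b - p] is orthogonal to the whole range, in particular to its own image under [T];
   coercivity then annihilates it. *)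
have : rnorm (b - p) ^+ 2 <= 0.
  rewrite -(ler_pM2l c0) mulr0; apply: le_trans (Tc _) _.
  by rewrite ort//; exists (b - p).
rewrite real_exprn_even_le0 ?num_real//= => /eqP/rnorm_eq0/eqP.
by rewrite subr_eq0 => /eqP ->; exists l.
Qed.

(** * The resolvent of A + t V *)

Section Resolvent.
Context {R : realType} {H : hilbertType R}.
Variables (A V : {linear H -> H}).

(** The coupling [t] is complex although the theorem has real [t] only: the Poisson formula exploits
    the holomorphic dependence on [t]. *)
Definition pencil (t z : R[i]) (x : H) : H := A x + t *: V x - z *: x.

Lemma pencil_is_linear t z : linear (pencil t z).
Proof.
move=> c x y; rewrite /pencil (linearP A) (linearP V) !scalerDr opprD !scalerN.
rewrite !scalerA (mulrC t c) (mulrC z c).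
by rewrite (addrACA (c *: A x)) (addrACA (c *: A x + _)).
Qed.

HB.instance Definition _ t z :=
  GRing.isLinear.Build R[i] H H *:%R (pencil t z) (pencil_is_linear t z).

Lemma pencil_shift t s z x : pencil t z x = pencil s z x + (t - s) *: V x.
Proof.
rewrite /pencil scalerBl [RHS]addrAC; congr (_ - _).
by rewrite -[RHS]addrA (addrC (s *: _)) subrK.
Qed.

Lemma pencil_shift_spectral t z w x : pencil t z x = pencil t w x + (w - z) *: x.
Proof.
by rewrite /pencil scalerBl addrA subrK.
Qed.

Hypotheses (A_bounded : bounded_op A) (V_bounded : bounded_op V).
Hypotheses (A_sa : selfadjoint A) (V_sa : selfadjoint V).
Hypothesis V_ge0 : forall x, 0 <= rdot (V x) x.

Lemma selfadjoint_Im (f : H -> H) x : selfadjoint f -> complex.Im '[x, f x] = 0.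
Proof.
move=> f_sa; have := innerC x (f x); rewrite f_sa.
by case: ('[x, f x]) => u v [] /= ?; lra.
Qed.

Lemma pencil_bounded t z : bounded_op (pencil t z).
Proof.
have [M M0 hA] := bounded_opP A_bounded; have [N N0 hV] := bounded_opP V_bounded.
exists (M + complex.Re `|t| * N + complex.Re `|z|) => x.
rewrite !rnormE -rmorphM lecR /pencil.
apply: le_trans (rnormD _ _) _; rewrite rnormN rnormZr !mulrDl lerD2r.
apply: le_trans (rnormD _ _) _; rewrite rnormZr -mulrA lerD// ler_wpM2l//.
by have := normr_ge0 t; rewrite lecE => /andP[].
Qed.

(** For [Im t <= 0 < Im z] both terms are nonnegative. The pencil stands in the conjugate-linear
    argument, which reverses the signs. *)
Lemma Im_pencil t z x : complex.Im '[x, pencil t z x] =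
  - complex.Im t * rdot (V x) x + complex.Im z * rnorm x ^+ 2.
Proof.
rewrite /pencil linearBr linearDr /= !innerZr.
rewrite -rdotxx rdotC /rdot.
have := selfadjoint_Im x A_sa; have := selfadjoint_Im x V_sa.
(* The identity is self-adjoint, so ['[x, x]] is real as well. *)
have := selfadjoint_Im x (fun _ _ => erefl : '[_, _] = '[_, _]).
case: ('[x, A x]) => a1 a2; case: ('[x, V x]) => v1 v2; case: ('[x, x]) => b1 b2 /=.
by move: t z => [t1 t2] [z1 z2] /= -> -> ->; ring.
Qed.

Variables (z : R[i]) (z_gt0 : 0 < complex.Im z).
Implicit Types (t s : R[i]) (h : H).

Lemma pencil_coercive t x : complex.Im t <= 0 ->
  complex.Im z * rnorm x ^+ 2 <= complex.Im '[x, pencil t z x].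
Proof.
by move=> t0; rewrite Im_pencil lerDr mulr_ge0 ?V_ge0// oppr_ge0.
Qed.

Lemma pencil_inj t x y : complex.Im t <= 0 ->
  pencil t z x = pencil t z y -> x = y.
Proof.
move=> t0 /eqP; rewrite -subr_eq0 -linearB => /eqP h.
have := pencil_coercive (x - y) t0; rewrite h linear0r /=.
rewrite -[0 in X in X -> _](mulr0 (complex.Im z)) ler_pM2l//.
rewrite real_exprn_even_le0 ?num_real//= => /eqP/rnorm_eq0/eqP.
by rewrite subr_eq0 => /eqP.
Qed.

(** The default value is irrelevant for [Im t <= 0], where coercivity makes the pencil bijective. *)
Definition resolvent t h : H := xget 0 [set r | pencil t z r = h].

Lemma resolventK t h : complex.Im t <= 0 -> pencil t z (resolvent t h) = h.
Proof.
move=> t0; have [r rh] := coercive_surjective (pencil_bounded t z) z_gt0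
  (fun x => pencil_coercive x t0) h.
by apply: (@xgetPex _ 0 [set r | pencil t z r = h]); exists r.
Qed.

Lemma resolvent_uniq t h r : complex.Im t <= 0 -> pencil t z r = h ->
  resolvent t h = r.
Proof. by move=> t0 rh; apply: (pencil_inj t0); rewrite resolventK. Qed.

Lemma resolventZ t c x : complex.Im t <= 0 ->
  resolvent t (c *: x) = c *: resolvent t x.
Proof.
by move=> t0; apply: resolvent_uniq => //; rewrite linearZ/= resolventK.
Qed.

(** The bound does not depend on [t]: it makes all later estimates uniform on the half-plane. *)
Lemma rnorm_resolvent t h : complex.Im t <= 0 ->
  rnorm (resolvent t h) <= (complex.Im z)^-1 * rnorm h.
Proof.
move=> t0; set r := resolvent t h; rewrite ler_pdivlMl//.
have [->|r0] := eqVneq (rnorm r) 0; first by rewrite mulr0 rnorm_ge0.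
have rp : 0 < rnorm r by rewrite lt_def r0 rnorm_ge0.
have := pencil_coercive r t0; rewrite resolventK// Im_inner => hr.
have := le_trans hr (rdot_le _ _); rewrite rnormZi.
by rewrite expr2 mulrA (mulrC (rnorm r) (rnorm h)) ler_pM2r.
Qed.

(** The second resolvent identity, the source of the derivative in [t] and of its remainder. *)
Lemma resolvent_sub t s h : complex.Im t <= 0 -> complex.Im s <= 0 ->
  resolvent t h = resolvent s h - (t - s) *: resolvent t (V (resolvent s h)).
Proof.
move=> t0 s0; apply: resolvent_uniq => //.
by rewrite linearB linearZ/= resolventK// (pencil_shift t s) resolventK// addrK.
Qed.

(** For real [t] only [z] contributes to the imaginary part. The Poisson representation is thereby
    reduced to a formula for the norm of the resolvent. *)
Lemma resolvent_Im t h : complex.Im t = 0 ->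
  complex.Im '[resolvent t h, h] = complex.Im z * rnorm (resolvent t h) ^+ 2.
Proof.
move=> t0; have t0' : complex.Im t <= 0 by rewrite t0.
by rewrite -{2}(resolventK h t0') Im_pencil t0 oppr0 mul0r add0r.
Qed.

End Resolvent.

(** * Spectral measures and the resolvent *)

(** Polarization: the difference of the forms at [x + y] and [x - y] is [4 rdot (D x) y], and it is
    bounded by [d] times [2 (rnorm x ^+ 2 + rnorm y ^+ 2)]. The set [P] will be the range of a
    spectral projection. *)
Lemma selfadjoint_numerical_radius (R : realType) (H : hilbertType R)
    (D : H -> H) (P : set H) (d : R) :
  linear D -> selfadjoint D ->
  (forall x y, P x -> P y -> P (x + y)) ->
  (forall (c : R) x, P x -> P (c%:C *: x)) -> (forall x, P x -> P (D x)) ->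
  (forall x, P x -> `|rdot (D x) x| <= d * rnorm x ^+ 2) ->
  forall x, P x -> rnorm (D x) <= d * rnorm x.
Proof.
move=> Dlin D_sa PD PZ PDD Pd x Px.
have d_x2 : 0 <= d * rnorm x ^+ 2 by apply: le_trans (Pd x Px).
have [x0|x0] := eqVneq (rnorm x) 0.
  have D0 : D 0 = 0.
    by have := Dlin (-1) 0 0; rewrite scaler0 addr0 scaleN1r addNr.
  by rewrite x0 mulr0 (rnorm_eq0 x0) D0 rnorm0.
have [Dx0|Dx0] := eqVneq (rnorm (D x)) 0.
  rewrite Dx0 -(ler_pM2r (_ : 0 < rnorm x)) ?lt_def ?x0 ?rnorm_ge0//.
  by rewrite mul0r -mulrA -expr2.
have xp : 0 < rnorm x by rewrite lt_def x0 rnorm_ge0.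
have Dxp : 0 < rnorm (D x) by rewrite lt_def Dx0 rnorm_ge0.
(* Rescaling [D x] to the norm of [x] turns [rdot (D x) y] into the product of the norms of [x] and
   [D x]. *)
pose s := rnorm x / rnorm (D x).
have sp : 0 < s by rewrite divr_gt0.
pose y := s%:C *: D x.
have Py : P y by apply: PZ; exact: PDD.
have ny : rnorm y = rnorm x by rewrite rnormZ gtr0_norm// divfK.
have DD u v : D (u + v) = D u + D v by have := Dlin 1 u v; rewrite !scale1r.
have DN u : D (- u) = - D u.
  have := Dlin (-1) u 0; have := Dlin (-1) 0 0.
  by rewrite scaler0 !addr0 !scaleN1r addNr => ->; rewrite addr0.
have PN u : P u -> P (- u).
  by move=> /(PZ (-1)); rewrite rmorphN rmorph1 scaleN1r.
have sym : rdot (D y) x = rdot (D x) y by rewrite /rdot D_sa -/(rdot _ _) rdotC.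
have h1 := Pd _ (PD _ _ Px Py); have h2 := Pd _ (PD _ _ Px (PN _ Py)).
move: h1 h2; rewrite !DD DN !rnormD_sq rnormN !rdotDl !rdotDr !rdotNl !rdotNr sym ny.
move=> /ler_normlP[_ h1] /ler_normlP[h2 _].
have h3 : rdot (D x) y <= d * rnorm x ^+ 2 by lra.
have : rdot (D x) y = rnorm x * rnorm (D x).
  by rewrite rdotZr rdotxx /s expr2 mulrA divfK.
move=> e; rewrite -(ler_pM2l xp) -e; apply: le_trans h3 _.
by rewrite expr2; rewrite mulrCA.
Qed.

Section SpectralResolvent.
Context {R : realType} {H : hilbertType R}.
Variables (T : H -> H) (E : set R -> {linear H -> H}) (M : R).
Variable mu : H -> {measure set R -> \bar R}.
Hypotheses (T_linear : linear T) (T_sa : selfadjoint T).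
Hypothesis E_pvm : projection_valued_measure E.
Hypothesis E_bounded : forall x, E `[- M, M]%classic x = x.
Hypothesis muE : forall x S, measurable S ->
  mu x S = (complex.Re '[E S x, x])%:E.
Hypothesis TE : forall x, '[T x, x] = (\int[mu x]_(l in setT) l)%:C.

Lemma pvm_sa S x y : measurable S -> '[E S x, y] = '[x, E S y].
Proof. by move=> mS; have [_] := pvm_proj E_pvm mS; apply. Qed.

Lemma pvm_idem S x : measurable S -> E S (E S x) = E S x.
Proof. by move=> mS; have [+ _] := pvm_proj E_pvm mS; apply. Qed.

Lemma mu_rnorm x S : measurable S -> mu x S = (rnorm (E S x) ^+ 2)%:E.
Proof.
by move=> mS; rewrite muE// -rdotxx /rdot -pvm_sa ?pvm_idem.
Qed.

Lemma mu_setT x : mu x setT = (rnorm x ^+ 2)%:E.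
Proof. by rewrite mu_rnorm// (pvm_setT E_pvm). Qed.

Lemma mu_lty x S : measurable S -> (mu x S < +oo)%E.
Proof. by move=> mS; rewrite mu_rnorm// ltry. Qed.

Lemma mu_concentrated x S : measurable S -> E S x = x -> mu x (~` S) = 0%E.
Proof.
move=> mS Sx; rewrite mu_rnorm; last exact: measurableC.
rewrite -Sx -(pvm_setI E_pvm) ?setICl//; last exact: measurableC.
by rewrite (pvm_set0 E_pvm) rnorm0 expr0n.
Qed.

(** Additivity of the scalar measure splits the squared norm of [x]. As the two projected parts are
    orthogonal, the squared norm of the defect expands to zero. *)
Lemma pvm_compl S x : measurable S -> x = E S x + E (~` S) x.
Proof.
move=> mS; have mS' := measurableC mS.
have : mu x setT = (mu x S + mu x (~` S))%E.
  by rewrite -measureU ?setICr// setUv.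
rewrite mu_setT !mu_rnorm// => -[h].
have o : rdot (E S x) (E (~` S) x) = 0.
  by rewrite /rdot pvm_sa// -(pvm_setI E_pvm)// setICr (pvm_set0 E_pvm) linear0r.
have e1 : rdot x (E S x) = rnorm (E S x) ^+ 2.
  by rewrite -rdotxx /rdot pvm_sa// pvm_idem.
have e2 : rdot x (E (~` S) x) = rnorm (E (~` S) x) ^+ 2.
  by rewrite -rdotxx /rdot pvm_sa// pvm_idem.
apply/eqP; rewrite -subr_eq0; apply/eqP/rnorm_eq0/eqP.
rewrite -sqrf_eq0 rnormB_sq rnormD_sq rdotDr o e1 e2 h; apply/eqP; ring.
Qed.

Lemma mu_integrable_id x : (mu x).-integrable setT (EFin \o @id R).
Proof.
have mI : measurable `[- M, M]%classic by exact: measurable_itv.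
apply/(negligible_integrable (N := ~` `[- M, M]%classic)).
- exact: measurableC.
- by [].
- exact/measurable_EFinP.
- exact: mu_concentrated.
rewrite setTD setCK; apply: measurable_bounded_integrable => //.
  exact: mu_lty.
exists M; split; first exact: num_real.
by move=> N MN l /=; rewrite in_itv /= -ler_norml => /le_trans; apply; exact: ltW.
Qed.

Lemma rdot_T x : rdot (T x) x = \int[mu x]_(l in setT) l.
Proof. by rewrite /rdot TE. Qed.

Lemma rdot_T_itv (a b : R) x : E `[a, b[%classic x = x ->
  a * rnorm x ^+ 2 <= rdot (T x) x <= b * rnorm x ^+ 2.
Proof.
set I := `[a, b[%classic => Ix.
have mI : measurable I by exact: measurable_itv.
have mC : measurable (~` I) by exact: measurableC.
have -> : rdot (T x) x = \int[mu x]_(l in I) l.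
  rewrite rdot_T /Rintegral (negligible_integral mC) ?setTD ?setCK//.
    exact: mu_integrable_id.
  exact: mu_concentrated.
have iI : (mu x).-integrable I (EFin \o @id R).
  by apply: integrableS (mu_integrable_id x).
have ic c : (mu x).-integrable I (EFin \o cst c).
  apply: measurable_bounded_integrable => //; first exact: mu_lty.
  by exists `|c|; split; rewrite ?num_real// => N cN l _ /=; exact: ltW.
have mIx : fine (mu x I) = rnorm x ^+ 2 by rewrite mu_rnorm// Ix.
rewrite -mIx -!(Rintegral_cst _ mI); apply/andP; split.
  apply: (le_Rintegral mI (ic a) iI) => l.
  by rewrite /I /= in_itv /= => /andP[].
apply: (le_Rintegral mI iI (ic b)) => l.
by rewrite /I /= in_itv /= => /andP[_ /ltW].
Qed.

(** Only the quadratic form of [T] is given by the measures. For [x] and [y] in complementary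
    spectral subspaces the measure of [x + y] is the sum of theirs, so the form is additive and its
    cross term vanishes. *)
Lemma T_orthogonal S x y : measurable S ->
  E S x = x -> E (~` S) y = y -> rdot (T x) y = 0.
Proof.
move=> mS Sx Sy; have mS' := measurableC mS.
have TD u v : T (u + v) = T u + T v by have := T_linear 1 u v; rewrite !scale1r.
have o Q : measurable Q -> rdot (E Q x) y = 0.
  move=> mQ; rewrite -Sx -Sy /rdot -pvm_sa// -!(pvm_setI E_pvm)//.
    by rewrite setIAC setICl set0I (pvm_set0 E_pvm) linear0l.
  exact: measurableI.
have muD Q : measurable Q -> mu (x + y) Q = measure_add (mu x) (mu y) Q.
  move=> mQ; rewrite measure_addE !muE// -EFinD; congr EFin.
  rewrite -!/(rdot _ _) linearD rdotDl !rdotDr o//.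
  rewrite (_ : rdot (E Q y) x = 0); first by ring.
  by rewrite rdotC /rdot -pvm_sa// -/(rdot _ _) o.
have : rdot (T (x + y)) (x + y) = rdot (T x) x + rdot (T y) y.
  rewrite !rdot_T /Rintegral (eq_measure_integral (measure_add (mu x) (mu y))).
    have := integral_measure_add measurableT (mu_integrable_id x)
      (mu_integrable_id y).
    move=> /= ->; rewrite fineD//;
      apply: (integrable_fin_num measurableT); exact: mu_integrable_id.
  by move=> Q mQ _; exact: muD.
rewrite TD rdotDl !rdotDr.
have -> : rdot (T y) x = rdot (T x) y by rewrite /rdot T_sa -/(rdot _ _) rdotC.
by lra.
Qed.

(** By [T_orthogonal], both off-diagonal blocks of [T] with respect to [E S] and its complement
    vanish. *)
Lemma T_commute S x : measurable S -> T (E S x) = E S (T x).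
Proof.
move=> mS; have mS' := measurableC mS.
have TD u v : T (u + v) = T u + T v by have := T_linear 1 u v; rewrite !scale1r.
have h Q : measurable Q -> E (~` Q) (T (E Q x)) = 0.
  move=> mQ; have mQ' := measurableC mQ.
  apply: rdot_ext => z; rewrite rdot0l /rdot pvm_sa// -/(rdot _ _).
  by apply: (T_orthogonal mQ); rewrite pvm_idem.
rewrite {2}(pvm_compl x mS) TD linearD.
have := h _ mS'; rewrite setCK => ->; rewrite addr0.
by rewrite {1}(pvm_compl (T (E S x)) mS) h// addr0.
Qed.

(** The range of [E I] is invariant under [T - l], whose form there is bounded by [b - a];
    self-adjointness upgrades this to a norm bound. *)
Lemma T_localized (a b l : R) x : a <= l <= b -> E `[a, b[%classic x = x ->
  rnorm (T x - l%:C *: x) <= (b - a) * rnorm x.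
Proof.
set I := `[a, b[%classic => /andP[al lb] Ix.
have mI : measurable I by exact: measurable_itv.
pose D u := T u - l%:C *: u.
have Dlin : linear D.
  move=> k u v; rewrite /D T_linear !scalerDr scalerN opprD !scalerA.
  by rewrite (mulrC l%:C) addrACA.
apply: (@selfadjoint_numerical_radius _ _ D [set u | E I u = u]) => //=.
- move=> u v; rewrite /D linearBl linearBr /= T_sa innerZl innerZr conjc_real.
  by [].
- by move=> u v uI vI; rewrite linearD uI vI.
- by move=> k u uI; rewrite linearZ uI.
- by move=> u uI; rewrite /D linearB linearZ /= -T_commute// uI.
- move=> u uI; have /andP[h1 h2] := rdot_T_itv uI.
  have u0 : 0 <= rnorm u ^+ 2 by rewrite exprn_ge0// rnorm_ge0.
  rewrite /D rdotBl rdotZl rdotxx ler_norml; apply/andP; split; nra.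
Qed.

(** To be read with [P] and [X] the norms of the localized [b] and [r], [w] the modulus of [l - z]
    and [d] the length of the interval. The constant collects [X <= P / y],
    [P + w X <= (2 + 1 / y) P] and [1 / w^2 <= 1 / y^2] in a difference of squares. *)
Lemma local_resolvent_estimate (y w X P d : R) : 0 < y -> y <= w -> 0 <= d <= 1 ->
  0 <= X -> `|P - w * X| <= d * X -> y * X <= P ->
  `|P ^+ 2 / w ^+ 2 - X ^+ 2| <= (2 + y^-1) / y ^+ 3 * d * P ^+ 2.
Proof.
move=> y0 yw /andP[d0 d1] X0 h yX.
have w0 : 0 < w by exact: lt_le_trans yw.
have P0 : 0 <= P by apply: le_trans yX; rewrite mulr_ge0// ltW.
have XP : X <= y^-1 * P by rewrite ler_pdivlMl.
have -> : P ^+ 2 / w ^+ 2 - X ^+ 2 = (P - w * X) * (P + w * X) / w ^+ 2.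
  by field; rewrite gt_eqF.
have wX0 : 0 <= w * X by rewrite mulr_ge0// ltW.
have wn : `|w ^+ 2| = w ^+ 2 by rewrite ger0_norm// exprn_ge0// ltW.
rewrite !normrM normfV (ger0_norm (addr_ge0 P0 wX0)) wn.
have hw : w * X <= P + d * X by move: h; rewrite ler_norml => /andP[]; lra.
have i0 : 0 < y^-1 by rewrite invr_gt0.
have dX : d * X <= y^-1 * P.
  by apply: le_trans XP; rewrite ler_piMl.
have s1 : `|P - w * X| * (P + w * X) <= d * (y^-1 * P) * (2 * P + y^-1 * P).
  apply: ler_pM => //; first exact: addr_ge0.
    by apply: le_trans h _; rewrite ler_wpM2l.
  by lra.
apply: (@le_trans _ _ (d * (y^-1 * P) * (2 * P + y^-1 * P) * (y ^+ 2)^-1)).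
  apply: ler_pM => //.
  - by rewrite mulr_ge0// addr_ge0.
  - by rewrite invr_ge0 exprn_ge0// ltW.
  - by rewrite lef_pV2 ?posrE ?exprn_gt0// ler_sqr ?nnegrE// ltW.
by rewrite le_eqVlt; apply/orP; left; apply/eqP; field; rewrite gt_eqF.
Qed.

Variables (c y : R) (y_gt0 : 0 < y) (r b : H).
Hypothesis rb : T r - (c +i* y) *: r = b.

(** The inverse square of the modulus of [l - z], for [z = c +i* y]. *)
Let f (l : R) := ((l - c) ^+ 2 + y ^+ 2)^-1.
Let K := (2 + y^-1) / y ^+ 3.

Let f_bnd l : 0 <= f l <= (y ^+ 2)^-1.
Proof.
have y2 : 0 < y ^+ 2 by rewrite exprn_gt0.
have l2 : 0 <= (l - c) ^+ 2 by exact: sqr_ge0.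
by rewrite /f invr_ge0 (addr_ge0 l2 (ltW y2)) /= lef_pV2 ?posrE ?ltr_wpDl// lerDr.
Qed.

Let f_measurable : measurable_fun setT f.
Proof.
apply: continuous_measurable_fun => l; apply: cvgV.
  by rewrite gt_eqF// ltr_wpDl ?sqr_ge0 ?exprn_gt0.
apply: cvgD; last exact: cvg_cst.
by apply: cvgM; (apply: cvgB; [exact: cvg_id|exact: cvg_cst]).
Qed.

Let f_integrable x S : measurable S -> (mu x).-integrable S (EFin \o f).
Proof.
move=> mS; apply: measurable_bounded_integrable => //; first exact: mu_lty.
  exact: measurable_funTS.
exists (y ^+ 2)^-1; split; first exact: num_real.
move=> N MN l _ /=; have /andP[f0 f1] := f_bnd l.
by rewrite ger0_norm// (le_trans f1)// ltW.
Qed.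

(** On a short interval [T] is close to the scalar [l], so [p] is close to [(l - z) x] and
    [f l * rnorm p ^+ 2] to [rnorm x ^+ 2]. The interval has mass [rnorm p ^+ 2] for [mu b]; the
    error keeps this factor, which makes it summable over subdivisions. *)
Let local_integral (a e : R) : a <= e -> e - a <= 1 ->
  `|\int[mu b]_(l in `[a, e[) f l - rnorm (E `[a, e[%classic r) ^+ 2|
    <= K * (e - a) * rnorm (E `[a, e[%classic b) ^+ 2.
Proof.
move=> ae ea1.
set I := `[a, e[%classic.
have mI : measurable I by exact: measurable_itv.
pose x := E I r; pose p := E I b.
have Ix : E I x = x by rewrite pvm_idem.
have pE : p = T x - (c +i* y) *: x by rewrite /p -rb linearB linearZ /= -T_commute.
have xp : y * rnorm x <= rnorm p.
  have [->|x0] := eqVneq (rnorm x) 0; first by rewrite mulr0 rnorm_ge0.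
  have x1 : 0 < rnorm x by rewrite lt_def x0 rnorm_ge0.
  rewrite -(ler_pM2r x1) -mulrA -expr2.
  (* The form of [T] is real, so the imaginary part of ['[p, x]] comes from [z] alone. *)
  have -> : y * rnorm x ^+ 2 = - rdot p ('i *: x).
    rewrite -Im_inner pE linearBl /= innerZl TE -inner_norm rnormE.
    by rewrite -rmorphXn; set n2 := rnorm x ^+ 2; move: n2 => n2 /=; ring.
  rewrite -rdotNl; apply: le_trans (rdot_le _ _) _.
  by rewrite rnormN rnormZi.
have hl l : I l -> `|rnorm p ^+ 2 * f l - rnorm x ^+ 2| <= K * (e - a) * rnorm p ^+ 2.
  rewrite /I /= in_itv /= => /andP[al le].
  have w2 : 0 <= (l - c) ^+ 2 + y ^+ 2 by rewrite addr_ge0 ?sqr_ge0.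
  pose w := Num.sqrt ((l - c) ^+ 2 + y ^+ 2).
  have wE : f l = (w ^+ 2)^-1 by rewrite sqr_sqrtr.
  rewrite wE; apply: local_resolvent_estimate => //.
  - by rewrite -[leLHS](gtr0_norm y_gt0) -sqrtr_sqr /w ler_sqrt// lerDr sqr_ge0.
  - by rewrite subr_ge0 ae.
  - exact: rnorm_ge0.
  - have h : rnorm (p - ((l - c) +i* - y) *: x) <= (e - a) * rnorm x.
      have -> : p - ((l - c) +i* - y) *: x = T x - l%:C *: x.
        rewrite pE -addrA -opprD -scalerDl; congr (_ - _ *: _).
        by apply/eqP; rewrite eq_complex /=; apply/andP; split; apply/eqP; ring.
      by apply: T_localized => //; rewrite al ltW.
    have wX : w * rnorm x = rnorm (((l - c) +i* - y) *: x).
      by rewrite rnormZr normc_def /= sqrrN.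
    rewrite wX; apply: le_trans h; rewrite ler_norml; apply/andP; split.
      have := rnorm_triangle p (((l - c) +i* - y) *: x) 0.
      by rewrite !subr0 (rnorm_distC _ p); lra.
    have := rnorm_triangle (((l - c) +i* - y) *: x) p 0.
    by rewrite !subr0; lra.
have muI : fine (mu b I) = rnorm p ^+ 2 by rewrite mu_rnorm.
have ic k : (mu b).-integrable I (EFin \o cst k).
  apply: measurable_bounded_integrable => //; first exact: mu_lty.
  by exists `|k|; split; rewrite ?num_real// => N cN l _ /=; exact: ltW.
(* The general case divides by the mass of [I]; when the mass is zero, so are the integral and
   [x]. *)
have [p0|p0] := eqVneq (rnorm p) 0.
  have x0 : rnorm x = 0.
    apply/eqP; rewrite eq_le rnorm_ge0 andbT -(ler_pM2l y_gt0) mulr0.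
    by rewrite -p0.
  rewrite -/x -/p x0 p0 expr0n /= mulr0 subr0 /Rintegral null_set_integral ?normr0//.
    exact/measurable_EFinP/measurable_funTS.
  by rewrite mu_rnorm// -/p p0 expr0n.
have P0 : 0 < rnorm p ^+ 2 by rewrite exprn_gt0// lt_def p0 rnorm_ge0.
rewrite -/x -/p ler_distl; apply/andP; split.
- rewrite (_ : _ - _ = (rnorm x ^+ 2 / rnorm p ^+ 2 - K * (e - a)) * fine (mu b I)); last first.
    by rewrite muI; field.
  rewrite -Rintegral_cst//; apply: (le_Rintegral mI (ic _) (f_integrable _ mI)) => l Il /=.
  rewrite -(ler_pM2l P0) mulrBr mulrCA divff ?gt_eqF// mulr1.
  by have := hl l Il; rewrite ler_distl => /andP[+ _]; lra.
- rewrite (_ : _ + _ = (rnorm x ^+ 2 / rnorm p ^+ 2 + K * (e - a)) * fine (mu b I)); last first.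
    by rewrite muI; field.
  rewrite -Rintegral_cst//; apply: (le_Rintegral mI (f_integrable _ mI) (ic _)) => l Il /=.
  rewrite -(ler_pM2l P0) mulrDr mulrCA divff ?gt_eqF// mulr1.
  by have := hl l Il; rewrite ler_distl => /andP[_]; lra.
Qed.

(* Bisection: the error of [local_integral] is quadratic in the length of the
   interval, so that it disappears on finer and finer subdivisions. *)
Let bisected_integral (eta : R) n (a e : R) : 0 < eta <= 1 -> a <= e ->
  e - a <= 2 ^+ n * eta ->
  `|\int[mu b]_(l in `[a, e[) f l - rnorm (E `[a, e[%classic r) ^+ 2|
    <= K * eta * rnorm (E `[a, e[%classic b) ^+ 2.
Proof.
move=> /andP[eta0 eta1].
have K0 : 0 <= K by rewrite divr_ge0 ?exprn_ge0 ?addr_ge0 ?invr_ge0 ?ltW.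
elim: n a e => [|n IH] a e ae h.
  rewrite mul1r in h; apply: le_trans (local_integral ae (le_trans h eta1)) _.
  by rewrite ler_wpM2r ?exprn_ge0 ?rnorm_ge0// ler_wpM2l.
pose m := (a + e) / 2.
have am : a <= m by rewrite /m; lra.
have me : m <= e by rewrite /m; lra.
have h1 : m - a <= 2 ^+ n * eta by rewrite exprS in h; rewrite /m; lra.
have h2 : e - m <= 2 ^+ n * eta by rewrite exprS in h; rewrite /m; lra.
have IE : `[a, e[%classic = `[a, m[%classic `|` `[m, e[%classic :> set R.
  by rewrite -itv_bndbnd_setU// bnd_simp.
have dis : `[a, m[%classic `&` `[m, e[%classic = set0 :> set R.
  apply/seteqP; split => // l [] /=; rewrite !in_itv /= => /andP[_ lm] /andP[ml _].
  by have := lt_le_trans lm ml; rewrite ltxx.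
have m1 : measurable `[a, m[%classic by exact: measurable_itv.
have m2 : measurable `[m, e[%classic by exact: measurable_itv.
have sq x : rnorm (E `[a, e[%classic x) ^+ 2 =
    rnorm (E `[a, m[%classic x) ^+ 2 + rnorm (E `[m, e[%classic x) ^+ 2.
  have : mu x `[a, e[%classic = (mu x `[a, m[%classic + mu x `[m, e[%classic)%E.
    by rewrite -measureU// -IE.
  by rewrite !mu_rnorm//= => -[].
rewrite !sq IE Rintegral_setU//; last 2 first.
- by rewrite -IE; exact: f_integrable.
- by apply/disj_setPS; rewrite dis.
have := IH _ _ am h1; have := IH _ _ me h2.
rewrite !ler_distl => /andP[u1 u2] /andP[u3 u4]; apply/andP; split; lra.
Qed.

(** The only instance of the functional calculus that is needed. *)
Lemma spectral_resolvent :
  (\int[mu b]_(l in setT) (((l - c) ^+ 2 + y ^+ 2)^-1)%:E)%E = (rnorm r ^+ 2)%:E.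
Proof.
have fT := f_integrable b measurableT.
rewrite -[LHS]fineK; last exact: (integrable_fin_num measurableT fT).
congr EFin.
(* The margin 1 makes the half-open interval contain the closed support; the absolute value is there
   because [M] may be negative. *)
pose N := `|M| + 1; pose I := `[- N, N[%classic.
have mI : measurable I by exact: measurable_itv.
have mC : measurable (~` I) by exact: measurableC.
have MI : `[- M, M]%classic `<=` I.
  move=> l; rewrite /I /= !in_itv /= => /andP[l1 l2]; apply/andP.
  by rewrite /N; have := ler_norm M; split; lra.
have EI x : E I x = x.
  rewrite -[in LHS](E_bounded x) -(pvm_setI E_pvm) ?(setIidr MI)//.
have NN : - N <= N by rewrite /N; have := normr_ge0 M; lra.
transitivity (\int[mu b]_(l in I) f l).
  rewrite /Rintegral (negligible_integral mC measurableT fT) ?setTD ?setCK//.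
  exact: mu_concentrated.
have K0 : 0 <= K by rewrite divr_ge0 ?exprn_ge0 ?addr_ge0 ?invr_ge0 ?ltW.
set J := \int[mu b]_(l in I) f l.
apply/eqP; rewrite -subr_eq0 -normr_le0; apply: le_of_eps => eps eps0.
rewrite add0r.
(* The summand 1 keeps the divisor of [eps] positive. *)
pose Q := K * rnorm b ^+ 2 + 1.
have Q0 : 0 < Q by rewrite ltr_wpDl// mulr_ge0// exprn_ge0// rnorm_ge0.
pose eta := Num.min 1 (eps / Q).
have eta0 : 0 < eta by rewrite lt_min ltr01 divr_gt0.
have eta1 : eta <= 1 by rewrite ge_min lexx.
have etaQ : eta * Q <= eps by rewrite -ler_pdivlMr// ge_min lexx orbT.
have [n hn] : exists n, (N - - N) / eta <= 2 ^+ n.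
  exists (Num.truncn ((N - - N) / eta)).+1.
  apply: le_trans (ltW (truncnS_gt _)) _.
  by rewrite -natrX ler_nat ltnW// ltn_expl.
have := @bisected_integral eta n (- N) N _ NN _.
rewrite -/I -/J !EI => /(_ _ _)/le_trans; apply.
- by rewrite eta0.
- by rewrite -ler_pdivrMr.
apply: le_trans etaQ; rewrite /Q mulrDr mulr1 (mulrC K) -mulrA.
by rewrite lerDl ltW.
Qed.

End SpectralResolvent.

(** * The Poisson formula of the lower half-plane *)

Section RealCalculus.
Context {R : realType}.
Implicit Types (f F g : R -> R) (a b x : R).

Lemma lipschitz_continuous f C : (forall x y, `|f x - f y| <= C * `|x - y|) ->
  continuous f.
Proof.
move=> fC x; apply/cvgrPdist_le => e e0.
have C0 : 0 <= C.
  by have /(le_trans (normr_ge0 _)) := fC 1 0; rewrite subr0 normr1 mulr1.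
have C1 : 0 < C + 1 by lra.
near=> y; apply: le_trans (fC x y) _.
apply: le_trans (ler_wpM2r (normr_ge0 _) (_ : C <= C + 1)) _; first by rewrite lerDl.
rewrite -ler_pdivlMl// mulrC; near: y.
apply/nbhs_ballP; exists (e / (C + 1)); first exact: divr_gt0.
by move=> z; exact: ltW.
Unshelve. all: end_near. Qed.

Lemma quadratic_is_derive F g C x :
  (forall h, `|F (x + h) - F x - g x * h| <= C * h ^+ 2) -> is_derive x (1 : R) F (g x).
Proof.
move=> Fg.
have C0 : 0 <= C by have /(le_trans (normr_ge0 _)) := Fg 1; rewrite expr1n mulr1.
have C1 : 0 < C + 1 by lra.
have lim : h^-1 *: (F (h *: 1 + x) - F x) @[h --> 0^'] --> g x.
  apply/cvgrPdist_le => e e0; near=> h.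
  have h0 : h != 0 by near: h; exact: nbhs_dnbhs_neq.
  have -> : g x - h^-1 *: (F (h *: 1 + x) - F x) =
      - h^-1 * (F (x + h) - F x - g x * h).
    by rewrite /GRing.scale /= mulr1 (addrC h); field.
  rewrite normrM normrN normfV ler_pdivrMl ?normr_gt0//.
  apply: le_trans (Fg h) _; rewrite -real_normK ?num_real// expr2 mulrCA mulrC.
  rewrite -mulrA mulrC -mulrA ler_wpM2l// mulrC.
  apply: (@le_trans _ _ ((C + 1) * `|h|)); first by rewrite ler_wpM2r// lerDl.
  rewrite -ler_pdivlMl// mulrC -[`|h|]normrN -sub0r; near: h.
  apply: nbhs_dnbhs; apply/nbhs_ballP.
  exists (e / (C + 1)); first exact: divr_gt0.
  by move=> z; exact: ltW.
apply: DeriveDef; last exact/cvg_lim.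
by apply/cvg_ex; exists (g x).
Unshelve. all: end_near. Qed.

Lemma continuous_itv_integrable f a b : continuous f ->
  lebesgue_measure.-integrable `[a, b] (EFin \o f).
Proof.
move=> cf; apply: continuous_compact_integrable; first exact: segment_compact.
exact: continuous_subspaceT.
Qed.

Lemma Rintegral_FTC2 F g a b : a < b -> continuous g ->
  (forall x, is_derive x (1 : R) F (g x)) ->
  \int[lebesgue_measure]_(x in `[a, b]) g x = F b - F a.
Proof.
move=> ab cg Fg; rewrite /Rintegral (@continuous_FTC2 R g F)//.
- exact: continuous_subspaceT.
- have dF x : derivable F x 1 by have [] := Fg x.
  have cF x : {for x, continuous F}.
    by apply: differentiable_continuous; exact/derivable1_diffP.
  split; [by move=> z _|apply: cvg_at_right_filter; exact: cF|apply: cvg_at_left_filter; exact: cF].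
- by move=> x _; rewrite derive1E; exact: derive_val.
Qed.

Lemma lebesgue_itv a b : a <= b ->
  fine (lebesgue_measure (`[a, b]%classic : set R)) = b - a.
Proof.
rewrite le_eqVlt => /predU1P[->|ab]; first by rewrite set_itv1 lebesgue_measure_set1 subrr.
by rewrite lebesgue_measure_itv /= lte_fin ab.
Qed.

Lemma Rintegral_itv_norm_le f a b B : a <= b -> continuous f ->
  (forall x, a <= x <= b -> `|f x| <= B) ->
  `|\int[lebesgue_measure]_(x in `[a, b]) f x| <= B * (b - a).
Proof.
move=> ab cf fB.
have m : measurable (`[a, b]%classic : set R) by exact: measurable_itv.
have int_cst k : lebesgue_measure.-integrable `[a, b] (EFin \o cst k : R -> \bar R).
  by apply: continuous_itv_integrable => x; exact: cvg_cst.
rewrite -(lebesgue_itv ab) ler_norml -mulNr; apply/andP; split.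
- rewrite -Rintegral_cst//.
  apply: le_Rintegral => //; first exact: int_cst.
    exact: continuous_itv_integrable.
  by move=> x /=; rewrite in_itv /= => /fB; rewrite ler_norml => /andP[].
- rewrite -Rintegral_cst//.
  apply: le_Rintegral => //; first exact: continuous_itv_integrable.
    exact: int_cst.
  by move=> x /=; rewrite in_itv /= => /fB; rewrite ler_norml => /andP[].
Qed.

End RealCalculus.

Section Modulus.
Context {R : realType}.
Implicit Types (z w : R[i]) (a : R).

Definition cmod z : R := complex.Re `|z|.

Lemma cmodE z : `|z| = (cmod z)%:C.
Proof. by rewrite /cmod RRe_real. Qed.

Lemma cmod_ge0 z : 0 <= cmod z.
Proof. by have := normr_ge0 z; rewrite cmodE ler0c. Qed.

Lemma cmodM z w : cmod (z * w) = cmod z * cmod w.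
Proof. by rewrite {1}/cmod normrM !cmodE -rmorphM. Qed.

Lemma cmodD z w : cmod (z + w) <= cmod z + cmod w.
Proof. by have := ler_normD z w; rewrite !cmodE -rmorphD lecR. Qed.

Lemma cmodN z : cmod (- z) = cmod z.
Proof. by rewrite /cmod normrN. Qed.

Lemma cmodB z w : cmod (z - w) = cmod (w - z).
Proof. by rewrite -cmodN opprB. Qed.

Lemma cmodV z : cmod z^-1 = (cmod z)^-1.
Proof. by rewrite {1}/cmod normfV cmodE -fmorphV. Qed.

Lemma cmod_sqr z : cmod z ^+ 2 = complex.Re z ^+ 2 + complex.Im z ^+ 2.
Proof. by rewrite /cmod normc_def sqr_sqrtr// addr_ge0 ?sqr_ge0. Qed.

Lemma norm_Re_le z : `|complex.Re z| <= cmod z.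
Proof.
rewrite -ler_sqr ?nnegrE ?cmod_ge0// cmod_sqr real_normK ?num_real//.
by rewrite lerDl sqr_ge0.
Qed.

Lemma norm_Im_le z : `|complex.Im z| <= cmod z.
Proof.
rewrite -ler_sqr ?nnegrE ?cmod_ge0// cmod_sqr real_normK ?num_real//.
by rewrite lerDr sqr_ge0.
Qed.

Lemma cmod_real a : cmod a%:C = `|a|.
Proof. by rewrite /cmod normc_def /= expr0n addr0 sqrtr_sqr. Qed.

Lemma cmod_imag a : cmod (0 +i* a) = `|a|.
Proof. by rewrite /cmod normc_def /= expr0n add0r sqrtr_sqr. Qed.

Lemma cmod_eq0 z : (cmod z == 0) = (z == 0).
Proof. by rewrite -(normr_eq0 z) cmodE -(inj_eq (@complexI R)). Qed.

Lemma cmod_gt0 z : (0 < cmod z) = (z != 0).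
Proof. by rewrite lt_def cmod_ge0 andbT cmod_eq0. Qed.

End Modulus.

(** * Cauchy's theorem on rectangles in the lower half-plane *)

Section LowerHalfPlane.
Context {R : realType}.
Implicit Types (f g : R[i] -> R[i]) (C : R).

(* A quantitative, uniform form of holomorphy on the closed lower half-plane. *)
Definition taylor2 f f' C := forall s t : R[i], complex.Im s <= 0 -> complex.Im t <= 0 ->
  [/\ cmod (f s) <= C, cmod (f' s) <= C, cmod (f t - f s) <= C * cmod (t - s) &
      cmod (f t - f s - f' s * (t - s)) <= C * cmod (t - s) ^+ 2].

Lemma taylor2_ge0 f f' C : taylor2 f f' C -> 0 <= C.
Proof. by move=> /(_ 0 0 (lexx _) (lexx _))[h _ _ _]; exact: le_trans (cmod_ge0 _) h. Qed.

(** The factor 3 counts the terms into which the remainder of the product splits. *)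
Lemma taylor2M f f' C g g' D : taylor2 f f' C -> taylor2 g g' D ->
  taylor2 (fun t => f t * g t) (fun t => f' t * g t + f t * g' t) (3 * (C * D)).
Proof.
move=> hf hg; have C0 := taylor2_ge0 hf; have D0 := taylor2_ge0 hg.
have CD0 : 0 <= C * D by exact: mulr_ge0.
move=> s t s0 t0.
have [f1 f2 f3 f4] := hf s t s0 t0; have [g1 g2 g3 g4] := hg s t s0 t0.
have [ft1 _ _ _] := hf t t t0 t0; have [gt1 _ _ _] := hg t t t0 t0.
have M0 (u v : R[i]) (a b : R) : cmod u <= a -> cmod v <= b -> cmod (u * v) <= a * b.
  by move=> ua vb; rewrite cmodM ler_pM ?cmod_ge0.
have h0 := cmod_ge0 (t - s).
split.
- by apply: le_trans (M0 _ _ _ _ f1 g1) _; lra.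
- apply: le_trans (cmodD _ _) _.
  by have := M0 _ _ _ _ f2 g1; have := M0 _ _ _ _ f1 g2; lra.
- have -> : f t * g t - f s * g s = (f t - f s) * g t + f s * (g t - g s) by ring.
  apply: le_trans (cmodD _ _) _.
  by have := M0 _ _ _ _ f3 gt1; have := M0 _ _ _ _ f1 g3; nra.
- have -> : f t * g t - f s * g s - (f' s * g s + f s * g' s) * (t - s) =
     f s * (g t - g s - g' s * (t - s)) + f' s * (g t - g s) * (t - s)
     + (f t - f s - f' s * (t - s)) * g t by ring.
  apply: le_trans (cmodD _ _) _; apply: le_trans (lerD (cmodD _ _) (lexx _)) _.
  have := M0 _ _ _ _ f1 g4; have := M0 _ _ _ _ (M0 _ _ _ _ f2 g3) (lexx (cmod (t - s))).
  by have := M0 _ _ _ _ f4 gt1; nra.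
Qed.

(** The pole [i tau] is at distance at least [tau] from the half-plane. The three powers bound the
    value, the derivative together with the increment, and the remainder. *)
Lemma taylor2_inv (tau : R) : 0 < tau ->
  taylor2 (fun t => (t - (0 +i* tau))^-1) (fun t => - ((t - (0 +i* tau))^-1) ^+ 2)
    (tau^-1 + tau^-1 ^+ 2 + tau^-1 ^+ 3).
Proof.
move=> tau0 s t s0 t0.
have i0 : 0 < tau^-1 by rewrite invr_gt0.
have lo u : complex.Im u <= 0 -> tau <= cmod (u - (0 +i* tau)).
  move=> u0; apply: le_trans (norm_Im_le _).
  by case: u u0 => a b /= b0; rewrite ler0_norm; lra.
have nz u : complex.Im u <= 0 -> u - (0 +i* tau) != 0.
  by move=> u0; rewrite -cmod_gt0; apply: lt_le_trans (lo u u0).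
have up u : complex.Im u <= 0 -> cmod (u - (0 +i* tau))^-1 <= tau^-1.
  move=> u0; rewrite cmodV lef_pV2 ?posrE ?lo//.
  by apply: lt_le_trans (lo u u0).
set p := (s - (0 +i* tau))^-1; set q := (t - (0 +i* tau))^-1.
have pq : q - p = - (q * p) * (t - s).
  by rewrite /p /q; field; rewrite !nz.
have p1 : cmod p <= tau^-1 := up _ s0.
have q1 : cmod q <= tau^-1 := up _ t0.
have cp := cmod_ge0 p; have cq := cmod_ge0 q.
have h0 := cmod_ge0 (t - s).
have i2 : 0 <= tau^-1 ^+ 2 by rewrite exprn_ge0// ltW.
have i3 : 0 <= tau^-1 ^+ 3 by rewrite exprn_ge0// ltW.
have qp2 : cmod q * cmod p <= tau^-1 ^+ 2 by rewrite expr2 ler_pM.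
have pp2 : cmod p * cmod p <= tau^-1 ^+ 2 by rewrite expr2 ler_pM.
split.
- by rewrite -/p; lra.
- by rewrite cmodN expr2 cmodM; lra.
- rewrite pq cmodM cmodN cmodM ler_wpM2r//; lra.
- have -> : q - p - - p ^+ 2 * (t - s) = q * p * p * (t - s) ^+ 2.
    rewrite (_ : _ - _ = - p * (t - s) * (q - p)); first by rewrite pq; ring.
    by rewrite {1}pq; ring.
  rewrite !cmodM expr2 ler_wpM2r ?mulr_ge0//.
  have : cmod q * cmod p * cmod p <= tau^-1 ^+ 3 by rewrite exprSr ler_pM// mulr_ge0.
  by lra.
Qed.

Section CauchyShift.
Variables (f f' : R[i] -> R[i]) (C : R) (hf : taylor2 f f' C).

Let w (x s : R) : R[i] := x -i* s.

Let w_low x s : 0 <= s -> complex.Im (w x s) <= 0.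
Proof. by move=> s0 /=; rewrite oppr_le0. Qed.

Let wBr x y s : w x s - w y s = (x - y)%:C.
Proof. by apply/eqP; rewrite eq_complex /= subrr !eqxx. Qed.

Lemma taylor2_horizontal s (pr : R[i] -> R) : 0 <= s ->
  (forall z, `|pr z| <= cmod z) -> {morph pr : x y / x - y} ->
  continuous (fun x => pr (f (w x s))).
Proof.
move=> s0 pr1 prB; apply: (@lipschitz_continuous _ _ C) => x y.
have [_ _ h _] := hf (w_low y s0) (w_low x s0).
by rewrite -prB; apply: le_trans (pr1 _) _; rewrite wBr cmod_real in h.
Qed.

Lemma taylor2_Im_continuous s : 0 <= s -> continuous (fun x => complex.Im (f (w x s))).
Proof.
by move=> s0; apply: taylor2_horizontal => // [z|x y]; [exact: norm_Im_le|rewrite raddfB].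
Qed.

(** Adding the expansions from [x] to [y] and from [y] to [x] cancels the values of [f] and leaves
    the increment of [f'] times [x - y], which makes [f'] Lipschitz. *)
Lemma taylor2_derivative_continuous s : 0 <= s ->
  continuous (fun x => complex.Re (f' (w x s))).
Proof.
move=> s0; apply: (@lipschitz_continuous _ _ (2 * C)) => x y.
have [->|xy] := eqVneq x y; first by rewrite !subrr normr0 mulr0.
have [_ _ _ h1] := hf (w_low y s0) (w_low x s0).
have [_ _ _ h2] := hf (w_low x s0) (w_low y s0).
rewrite -raddfB; apply: le_trans (norm_Re_le _) _.
have xy0 : 0 < `|x - y| by rewrite normr_gt0 subr_eq0.
rewrite -(ler_pM2r xy0) -[X in _ * X <= _]cmod_real -cmodM -(wBr x y s).
have -> : (f' (w x s) - f' (w y s)) * (w x s - w y s) =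
    (f (w x s) - f (w y s) - f' (w y s) * (w x s - w y s)) +
    (f (w y s) - f (w x s) - f' (w x s) * (w y s - w x s)) by ring.
apply: le_trans (cmodD _ _) _; apply: le_trans (lerD h1 h2) _.
by rewrite (cmodB (w y s)) wBr cmod_real; lra.
Qed.

Lemma taylor2_horizontal_derive s x : 0 <= s ->
  is_derive x (1 : R) (fun x => complex.Re (f (w x s))) (complex.Re (f' (w x s))).
Proof.
move=> s0; apply: (@quadratic_is_derive _ _ (fun x => complex.Re (f' (w x s))) C) => h.
have [_ _ _] := hf (w_low x s0) (w_low (x + h) s0).
have -> : w (x + h) s - w x s = h%:C by rewrite wBr addrC addKr.
rewrite cmod_real real_normK ?num_real// => hx.
apply: le_trans hx; apply: le_trans (norm_Re_le _); rewrite !raddfB /=.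
by case: (f' (w x s)) => a b /=; rewrite mulr0 subr0.
Qed.

Definition strip_integral (T s : R) : R :=
  \int[lebesgue_measure]_(x in `[- T, T]) complex.Im (f (w x s)).

(* Cauchy-Riemann: the derivative in [s] of [strip_integral] is a boundary
   term. *)
Lemma strip_integral_step T s h : 0 < T -> 0 <= s -> 0 <= h ->
  `|strip_integral T (s + h) - strip_integral T s
    + h * (complex.Re (f (w T s)) - complex.Re (f (w (- T) s)))|
  <= 2 * T * C * h ^+ 2.
Proof.
move=> T0 s0 h0.
have sh0 : 0 <= s + h by exact: addr_ge0.
have TT : - T < T by lra.
have mI : measurable (`[- T, T]%classic : set R) by exact: measurable_itv.
have c1 := taylor2_Im_continuous sh0; have c2 := taylor2_Im_continuous s0.
have c3 := taylor2_derivative_continuous s0.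
(* The boundary term is the integral of the real part of [f']. Going down by [h] adds about
   [- i h f'] to [f], whose imaginary part is [- h] times that real part, so under one integral only
   the Taylor remainder is left. *)
rewrite -(Rintegral_FTC2 TT c3 (fun x => taylor2_horizontal_derive x s0)).
have c4 : continuous (fun x => h * complex.Re (f' (w x s))).
  by move=> x; apply: cvgM; [exact: cvg_cst|exact: c3].
have c5 : continuous (fun x => complex.Im (f (w x (s + h))) - complex.Im (f (w x s))).
  by move=> x; apply: cvgB; [exact: c1|exact: c2].
rewrite -RintegralZl//; last exact: continuous_itv_integrable.
rewrite -RintegralB//; [|exact: continuous_itv_integrable..].
rewrite -RintegralD//; [|exact: continuous_itv_integrable..].
have -> : 2 * T * C * h ^+ 2 = C * h ^+ 2 * (T - - T) by ring.
apply: Rintegral_itv_norm_le; first exact: ltW.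
  by move=> x; apply: cvgD; [exact: c5|exact: c4].
move=> x _.
have [_ _ _] := hf (w_low x s0) (w_low x sh0).
have -> : w x (s + h) - w x s = 0 +i* - h.
  by apply/eqP; rewrite eq_complex /= subrr eqxx /=; apply/eqP; ring.
rewrite cmod_imag normrN real_normK ?num_real// => hx.
apply: le_trans hx; apply: le_trans (norm_Im_le _); rewrite !raddfB /=.
case: (f' (w x s)) => a b /=; rewrite le_eqVlt; apply/orP; left; apply/eqP; congr `|_|.
by ring.
Qed.

(** With [N.+1] steps of length [s / N.+1], the quadratic errors add up to a multiple of [1 / N.+1],
    while the boundary terms add up to at most [2 s B]. *)
Lemma strip_integral_shift T s B : 0 < T -> 0 <= s ->
  (forall v, 0 <= v <= s -> cmod (f (w T v)) <= B) ->
  (forall v, 0 <= v <= s -> cmod (f (w (- T) v)) <= B) ->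
  `|strip_integral T s - strip_integral T 0| <= 2 * s * B.
Proof.
move=> T0 s0 hB1 hB2.
have C0 := taylor2_ge0 hf.
apply: le_of_eps => e e0.
pose Q := 2 * T * C * s ^+ 2 + 1.
have Q0 : 0 < Q.
  by rewrite ltr_wpDl// mulr_ge0 ?exprn_ge0// mulr_ge0// mulr_ge0// ltW.
have [N /(_ N (leqnn _)) hN] := archi_inv (divr_gt0 e0 Q0).
pose h := s / N.+1%:R.
have h0 : 0 <= h by rewrite divr_ge0.
have hs : h * N.+1%:R = s by rewrite divfK.
have step k : (k <= N.+1)%N ->
   `|strip_integral T (h * k%:R) - strip_integral T 0| <=
     k%:R * (2 * T * C * h ^+ 2 + 2 * h * B).
  elim: k => [|k IH] kN; first by rewrite mulr0 subrr normr0 mul0r.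
  have k0 : 0 <= h * k%:R by rewrite mulr_ge0.
  have ks : 0 <= h * k%:R <= s.
    by rewrite k0 /= -hs ler_wpM2l// ler_nat ltnW.
  have := strip_integral_step T0 k0 h0; have := IH (ltnW kN).
  have := le_trans (norm_Re_le _) (hB1 _ ks); have := le_trans (norm_Re_le _) (hB2 _ ks).
  rewrite -(natr1 k) (mulrDr h k%:R) mulr1 !ler_norml.
  move: (strip_integral _ _) (strip_integral _ _) (strip_integral _ _) => i1 i2 i3.
  move: (complex.Re _) (complex.Re _) => r1 r2.
  move=> /andP[a1 a2] /andP[b1 b2] /andP[c1 c2] /andP[d1 d2].
  by apply/andP; split; nra.
have := step N.+1 (leqnn _); rewrite hs => /le_trans; apply.
rewrite mulrDr addrC; apply: lerD.
  by rewrite le_eqVlt; apply/orP; left; apply/eqP; rewrite -hs; ring.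
have -> : N.+1%:R * (2 * T * C * h ^+ 2) = 2 * T * C * s ^+ 2 * N.+1%:R^-1.
  by rewrite -hs; field; rewrite addrC natr1 pnatr_eq0.
apply: (@le_trans _ _ (Q * N.+1%:R^-1)).
  by rewrite ler_wpM2r ?invr_ge0// lerDl.
by rewrite mulrC -ler_pdivlMr.
Qed.

(* Push the segment [-T, T] down by [T + tau]. *)
Lemma lower_half_plane_decay T tau A : 0 < tau <= T ->
  (forall t, complex.Im t <= 0 -> cmod (f t) * cmod (t ^+ 2 + (tau ^+ 2)%:C) <= A) ->
  `|strip_integral T 0| <= 6 * A / T.
Proof.
move=> /andP[tau0 tauT] fA.
have T0 : 0 < T by exact: lt_le_trans tauT.
have fac t : t ^+ 2 + (tau ^+ 2)%:C = (t - (0 +i* tau)) * (t + (0 +i* tau)).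
  case: t => a b; rewrite !expr2; apply/eqP; rewrite eq_complex /=.
  by apply/andP; split; apply/eqP; ring.
have fbnd t : complex.Im t <= 0 -> T <= cmod (t - (0 +i* tau)) ->
    T <= cmod (t + (0 +i* tau)) -> cmod (f t) <= A / T ^+ 2.
  move=> t0 h1 h2; have := fA t t0; rewrite fac cmodM => h.
  rewrite ler_pdivlMr ?exprn_gt0//; apply: le_trans h.
  by rewrite ler_wpM2l ?cmod_ge0// expr2 ler_pM// ltW.
(* The extra [tau] keeps the bottom side at distance [T] from [- i tau], the lower zero of
   [t ^+ 2 + tau ^+ 2]. *)
pose s := T + tau.
have s0 : 0 <= s by rewrite addr_ge0// ltW.
have reB x v : `|x| = T -> 0 <= v -> cmod (f (w x v)) <= A / T ^+ 2.
  move=> xT v0; apply: fbnd; first exact: w_low.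
    apply: le_trans (norm_Re_le _) => /=; by rewrite subr0 xT.
  by apply: le_trans (norm_Re_le _) => /=; rewrite addr0 xT.
have h1 : `|strip_integral T s - strip_integral T 0| <= 2 * s * (A / T ^+ 2).
  by apply: strip_integral_shift => // v /andP[v0 _]; apply: reB; rewrite ?normrN ?gtr0_norm.
have h2 : `|strip_integral T s| <= A / T ^+ 2 * (T - - T).
  apply: Rintegral_itv_norm_le; first lra.
    exact: taylor2_Im_continuous.
  move=> x _; apply: le_trans (norm_Im_le _) _; apply: fbnd; first exact: w_low.
    by apply: le_trans (norm_Im_le _) => /=; rewrite ler0_norm /s; lra.
  by apply: le_trans (norm_Im_le _) => /=; rewrite ler0_norm /s; lra.
have A0 : 0 <= A.
  by apply: le_trans (fA 0 (lexx _)); rewrite mulr_ge0 ?cmod_ge0.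
(* The constant 6 is 4 for the two vertical sides, of length [s <= 2 T] each, plus 2 for the bottom
   of length [2 T]. *)
have e1 : 6 * A / T = A / T ^+ 2 * (6 * T) by field; rewrite gt_eqF.
have B0 : 0 <= A / T ^+ 2 by rewrite divr_ge0// exprn_ge0// ltW.
have h3 : 2 * s * (A / T ^+ 2) <= A / T ^+ 2 * (4 * T).
  by rewrite mulrC ler_wpM2l// /s; lra.
rewrite e1 -[strip_integral T 0](subKr (strip_integral T s)).
apply: le_trans (ler_normB _ _) _.
by have := lerD h2 (le_trans h1 h3); lra.
Qed.

End CauchyShift.

End LowerHalfPlane.

(** The Poisson kernel of the half-plane without the factor [1 / pi]; its total integral is [pi]. *)
Definition poisson (R : realType) (y x : R) : R := y / (x ^+ 2 + y ^+ 2).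

Section PoissonKernel.
Context {R : realType}.
Implicit Types (a b c x y : R).

Lemma poisson_ge0 y x : 0 < y -> 0 <= poisson y x.
Proof. by move=> y0; rewrite divr_ge0 ?addr_ge0 ?sqr_ge0// ltW. Qed.

Lemma poisson_continuous y : 0 < y -> continuous (poisson y).
Proof.
move=> y0 x; apply: cvgM; first exact: cvg_cst.
apply: cvgV; first by rewrite gt_eqF// ltr_wpDl ?sqr_ge0// exprn_gt0.
by apply: cvgD; [apply: cvgM; exact: cvg_id|exact: cvg_cst].
Qed.

Lemma is_derive_atan_poisson y c x : 0 < y ->
  is_derive x (1 : R) (fun x => atan ((x - c) / y)) (poisson y (x - c)).
Proof.
move=> y0.
have -> : poisson y (x - c) = (1 + ((x - c) / y) ^+ 2)^-1 * y^-1.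
  rewrite /poisson; field.
  by rewrite !gt_eqF// ltr_pwDl ?sqr_ge0// exprn_gt0.
apply: (@is_derive1_comp _ atan (fun x => (x - c) / y)).
have -> : (fun x => (x - c) / y) = (fun x => y^-1 *: (x - c)).
  by apply/funext => z; rewrite /GRing.scale /= mulrC.
have h : is_derive x (1 : R) (fun x : R => x - c) 1.
  by have := is_derive_shift x (1 : R) (- c).
have := @is_deriveZ _ _ _ (fun x => x - c) y^-1 x 1 1 h.
by rewrite /GRing.scale /= mulr1.
Qed.

Lemma Rintegral_poisson y c a b : 0 < y -> a < b ->
  \int[lebesgue_measure]_(x in `[a, b]) poisson y (x - c) =
  atan ((b - c) / y) - atan ((a - c) / y).
Proof.
move=> y0 ab.
apply: (@Rintegral_FTC2 _ (fun x => atan ((x - c) / y)) (fun x => poisson y (x - c))).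
- by [].
- move=> x; apply: (@continuous_comp _ _ _ (fun x => x - c) (poisson y)); last exact: poisson_continuous.
  by apply: cvgB; [exact: cvg_id|exact: cvg_cst].
- by move=> x; exact: is_derive_atan_poisson.
Qed.

End PoissonKernel.

(** * The Poisson formula for the resolvent as a function of the coupling *)

Section PoissonFormula.
Context {R : realType} {H : hilbertType R}.
Variables (A V : {linear H -> H}).
Hypotheses (A_bounded : bounded_op A) (V_bounded : bounded_op V).
Hypotheses (A_sa : selfadjoint A) (V_sa : selfadjoint V).
Hypothesis V_ge0 : forall x, 0 <= rdot (V x) x.
Variables (z : R[i]) (z_gt0 : 0 < complex.Im z).

Let Rv := resolvent A V z.

Let Rv_sub t s h : complex.Im t <= 0 -> complex.Im s <= 0 ->
  Rv t h = Rv s h - (t - s) *: Rv t (V (Rv s h)).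
Proof. exact: resolvent_sub. Qed.

Let Rv_bnd t h : complex.Im t <= 0 -> rnorm (Rv t h) <= (complex.Im z)^-1 * rnorm h.
Proof. exact: rnorm_resolvent. Qed.

Let inner_bnd (u v : H) (a c : R) : rnorm u <= a -> rnorm v <= c ->
  cmod '[u, v] <= a * c.
Proof.
move=> ua vc; apply: le_trans (norm_inner_le u v) _.
by rewrite ler_pM ?rnorm_ge0.
Qed.

(** One use of the second resolvent identity gives the increment; a second one leaves [(t - s) ^+ 2]
    times a form with three resolvents and two factors [V]. *)
Lemma resolvent_taylor2 p q : exists C : R,
  taylor2 (fun t => '[Rv t p, q]) (fun t => - '[Rv t (V (Rv t p)), q]) C.
Proof.
have [N N0 VN] := bounded_opP V_bounded.
pose c := (complex.Im z)^-1.
have c0 : 0 < c by rewrite invr_gt0.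
pose k := rnorm p * rnorm q.
have k0 : 0 <= k by rewrite mulr_ge0 ?rnorm_ge0.
(* Bounds for the forms with zero, one and two factors [V] between resolvents. *)
pose a1 := c * k; pose a2 := c * N * a1; pose a3 := c * N * a2.
have cN0 : 0 <= c * N by rewrite mulr_ge0 ?ltW.
have a10 : 0 <= a1 by rewrite mulr_ge0// ltW.
have a20 : 0 <= a2 by rewrite mulr_ge0.
have a30 : 0 <= a3 by rewrite mulr_ge0.
exists (a1 + a2 + a3) => s t s0 t0.
have RV u h : complex.Im u <= 0 -> rnorm (Rv u (V h)) <= c * N * rnorm h.
  move=> u0; apply: le_trans (Rv_bnd _ u0) _.
  by rewrite -mulrA ler_wpM2l// ltW.
have b1 u : complex.Im u <= 0 -> rnorm (Rv u p) <= c * rnorm p by exact: Rv_bnd.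
have b2 u v : complex.Im u <= 0 -> complex.Im v <= 0 ->
    rnorm (Rv u (V (Rv v p))) <= c * N * (c * rnorm p).
  by move=> u0 v0; apply: le_trans (RV _ _ u0) _; rewrite ler_wpM2l// b1.
have lq := lexx (rnorm q).
have E1 : '[Rv t p, q] - '[Rv s p, q] = - (t - s) * '[Rv t (V (Rv s p)), q].
  by rewrite -linearBl /= (Rv_sub p t0 s0) addrAC subrr add0r -scaleNr innerZl.
have B2 u v : complex.Im u <= 0 -> complex.Im v <= 0 ->
    cmod '[Rv u (V (Rv v p)), q] <= a2.
  move=> u0 v0; apply: le_trans (inner_bnd (b2 _ _ u0 v0) lq) _.
  by rewrite /a2 /a1 /k; lra.
split.
- by apply: le_trans (inner_bnd (b1 _ s0) lq) _; rewrite -mulrA -/k -/a1; lra.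
- by rewrite cmodN; apply: le_trans (B2 _ _ s0 s0) _; lra.
- rewrite E1 cmodM cmodN mulrC ler_wpM2r ?cmod_ge0//.
  by apply: le_trans (B2 _ _ t0 s0) _; lra.
- have -> : '[Rv t p, q] - '[Rv s p, q] - - '[Rv s (V (Rv s p)), q] * (t - s) =
      (t - s) ^+ 2 * '[Rv t (V (Rv s (V (Rv s p)))), q].
    rewrite E1 (Rv_sub (V (Rv s p)) t0 s0) linearBl /= innerZl.
    by ring.
  rewrite cmodM expr2 cmodM -expr2 mulrC ler_wpM2r ?exprn_ge0 ?cmod_ge0//.
  have := inner_bnd (le_trans (RV t _ t0) (ler_wpM2l cN0 (b2 _ _ s0 s0))) lq.
  by rewrite /a3 /a2 /a1 /k; move: a20 a10; rewrite /a2 /a1 /k; lra.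
Qed.

(** The function [f t = (Phi t - Phi (- i tau)) / (t ^+ 2 + tau ^+ 2)] is holomorphic in the
    half-plane, the subtraction removing the pole at [- i tau], and decays quadratically. Its
    integral over the segment is therefore small, and for real [t] its imaginary part compares the
    two terms. The constant 12 is 6 from [lower_half_plane_decay] times 2 from bounding the
    numerator. *)
Lemma poisson_formula (b : H) (T tau : R) : 0 < tau <= T ->
  `|\int[lebesgue_measure]_(x in `[- T, T])
       (tau * poisson tau x * complex.Im '[Rv x%:C b, b])
    - 2 * tau * atan (T / tau) * complex.Im '[Rv (0 -i* tau) b, b]|
  <= 12 * ((complex.Im z)^-1 * rnorm b ^+ 2) * tau ^+ 2 / T.
Proof.
move=> /andP[tau0 tauT]; have T0 : 0 < T by exact: lt_le_trans tauT.
pose t0 : R[i] := 0 -i* tau.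
have t0_low : complex.Im t0 <= 0 by rewrite /= oppr_le0 ltW.
(* By the resolvent identity, [Theta] is the difference quotient of [Phi] between [t] and [t0],
   defined at [t0] too. *)
pose p := - V (Rv t0 b).
pose Theta t := '[Rv t p, b].
pose f t := Theta t * (t - (0 +i* tau))^-1.
have [C hTheta] := resolvent_taylor2 p b.
have hf := taylor2M hTheta (taylor2_inv tau0).
pose Phi t := '[Rv t b, b].
pose a := (complex.Im z)^-1 * rnorm b ^+ 2.
have Phi_bnd t : complex.Im t <= 0 -> cmod (Phi t) <= a.
  move=> tl; apply: le_trans (inner_bnd (Rv_bnd b tl) (lexx _)) _.
  by rewrite /a expr2 mulrA.
have fE t : complex.Im t <= 0 -> f t * (t ^+ 2 + (tau ^+ 2)%:C) = Phi t - Phi t0.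
  move=> tl.
  have nz : t - (0 +i* tau) != 0.
    case: t tl => u v /= v0; rewrite eq_complex /= negb_and; apply/orP; right.
    by rewrite lt_eqF//; lra.
  have -> : t ^+ 2 + (tau ^+ 2)%:C = (t - (0 +i* tau)) * (t - t0).
    case: t {tl nz} => u v; rewrite !expr2; apply/eqP; rewrite eq_complex /=.
    by apply/andP; split; apply/eqP; ring.
  rewrite /f mulrA divfK// /Phi -linearBl /= (Rv_sub b tl t0_low).
  rewrite addrAC subrr add0r -scaleNr innerZl /Theta /p.
  have -> : Rv t (- V (Rv t0 b)) = - Rv t (V (Rv t0 b)).
    by rewrite -scaleN1r /Rv resolventZ// scaleN1r.
  by rewrite linearNl; ring.
have fA t : complex.Im t <= 0 -> cmod (f t) * cmod (t ^+ 2 + (tau ^+ 2)%:C) <= 2 * a.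
  move=> tl; rewrite -cmodM fE//; apply: le_trans (cmodD _ _) _.
  by rewrite cmodN; have := Phi_bnd t tl; have := Phi_bnd t0 t0_low; lra.
have tT : 0 < tau <= T by rewrite tau0.
have := lower_half_plane_decay hf tT fA.
have -> : strip_integral (fun t => f t) T 0 =
    \int[lebesgue_measure]_(x in `[- T, T]) complex.Im (f x%:C).
  rewrite /strip_integral; apply: eq_Rintegral => x _ /=.
  by rewrite oppr0.
move=> decay.
have q0 x : 0 < x ^+ 2 + tau ^+ 2 by rewrite ltr_wpDl ?sqr_ge0// exprn_gt0.
have ImE x : tau * poisson tau x * complex.Im (Phi x%:C) =
    tau ^+ 2 * complex.Im (f x%:C) + (tau * complex.Im (Phi t0)) * poisson tau x.
  have := fE x%:C (lexx _); rewrite -rmorphXn -rmorphD => /(congr1 (@complex.Im R)).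
  rewrite raddfB /= => e.
  have {}e : complex.Im (f x%:C) * (x ^+ 2 + tau ^+ 2) =
      complex.Im (Phi x%:C) - complex.Im (Phi t0).
    by rewrite -e; case: (f x%:C) => u v /=; rewrite mulr0 add0r mulrC.
  have -> : complex.Im (Phi x%:C) = complex.Im (f x%:C) * (x ^+ 2 + tau ^+ 2) +
      complex.Im (Phi t0) by rewrite e subrK.
  by rewrite /poisson; field; rewrite gt_eqF// addrC.
have cIm : continuous (fun x : R => complex.Im (f x%:C)).
  have := taylor2_Im_continuous hf (lexx 0).
  by rewrite oppr0.
have cp := poisson_continuous tau0.
under eq_Rintegral do rewrite ImE.
rewrite RintegralD//; last 2 first.
- apply: continuous_itv_integrable => x; apply: cvgM; first exact: cvg_cst.
  exact: cIm.
- apply: continuous_itv_integrable => x; apply: cvgM; first exact: cvg_cst.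
  exact: cp.
have i1 := @continuous_itv_integrable _ _ (- T) T cIm.
have i2 := @continuous_itv_integrable _ _ (- T) T cp.
rewrite (RintegralZl _ _ i1)// (RintegralZl _ _ i2)//.
have -> : \int[lebesgue_measure]_(x in `[- T, T]) poisson tau x = 2 * atan (T / tau).
  have TT : - T < T by lra.
  have := Rintegral_poisson 0 tau0 TT.
  under eq_Rintegral do rewrite subr0.
  by move=> ->; rewrite !subr0 mulNr atanN opprK; ring.
rewrite -/t0 -/(Phi t0).
have -> : tau * complex.Im (Phi t0) * (2 * atan (T / tau)) =
   2 * tau * atan (T / tau) * complex.Im (Phi t0) by ring.
rewrite addrK normrM ger0_norm ?sqr_ge0//.
apply: le_trans (ler_wpM2l (sqr_ge0 tau) decay) _.
by rewrite le_eqVlt; apply/orP; left; apply/eqP; rewrite /a; ring.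
Qed.

End PoissonFormula.

(** * The behaviour at - i infinity *)

Section InverseOperator.
Context {R : realType} {K : hilbertType R}.
Variables (Gamma : {linear K -> K}).
Hypotheses (Gamma_bounded : bounded_op Gamma) (Gamma_sa : selfadjoint Gamma).
Hypotheses (Gamma_ge0 : nonnegative_op Gamma) (Gamma_inv : boundedly_invertible Gamma).

Lemma inverseP : is_inverse Gamma (inverse Gamma).
Proof.
have [g gP _] := Gamma_inv.
by have := @xgetPex _ (fun=> 0) [set g | is_inverse Gamma g] (ex_intro _ g gP).
Qed.

Lemma inverse_bounded : exists2 M : R, 0 < M &
  forall x, rnorm (inverse Gamma x) <= M * rnorm x.
Proof.
have [g [gK Kg] gb] := Gamma_inv; have [GK KG] := inverseP.
have [M M0 gM] := bounded_opP gb.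
by exists M => // x; rewrite -{1}(Kg x) GK.
Qed.

Lemma inverse_sa x y : '[inverse Gamma x, y] = '[x, inverse Gamma y].
Proof.
have [GK KG] := inverseP.
by rewrite -{1}(KG y) -Gamma_sa KG.
Qed.

Lemma nonnegative_rdot x : 0 <= rdot (Gamma x) x.
Proof. by have := Gamma_ge0 x; rewrite lecE => /andP[]. Qed.

(** Nonnegativity at [x - N^-1 Gamma x] bounds the squared norm of [Gamma x] by
    [N * rdot (Gamma x) x] without a square root of [Gamma]; the inverse bounds [x] by [M] times
    [Gamma x]. *)
Lemma nonnegative_coercive : exists2 c : R, 0 < c &
  forall x, c * rnorm x ^+ 2 <= rdot (Gamma x) x.
Proof.
have [GK KG] := inverseP.
have [N N0 hN] := bounded_opP Gamma_bounded.
have [M M0 hM] := inverse_bounded.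
exists (N * M ^+ 2)^-1; first by rewrite invr_gt0 mulr_gt0// exprn_gt0.
move=> x; set g := Gamma x.
have h1 := nonnegative_rdot (x - (N^-1)%:C *: g).
have h2 : rdot (Gamma g) g <= N * rnorm g ^+ 2.
  apply: le_trans (rdot_le _ _) _.
  by rewrite expr2 mulrA ler_wpM2r ?rnorm_ge0.
have h3 : rnorm g ^+ 2 <= N * rdot g x.
  move: h1; rewrite linearB linearZ /= -/g rdotBl !rdotBr !rdotZl !rdotZr.
  have -> : rdot (Gamma g) x = rnorm g ^+ 2.
    by rewrite /rdot Gamma_sa -/g -/(rdot _ _) rdotxx.
  rewrite rdotxx => h1.
  have i0 : 0 < N^-1 by rewrite invr_gt0.
  have h4 : N^-1 * (N^-1 * rdot (Gamma g) g) <= N^-1 * rnorm g ^+ 2.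
    by rewrite ler_wpM2l ?(ltW i0)// ler_pdivrMl.
  rewrite -ler_pdivrMl//; lra.
have h5 : rnorm x ^+ 2 <= M ^+ 2 * rnorm g ^+ 2.
  rewrite -exprMn ler_sqr ?nnegrE ?mulr_ge0 ?rnorm_ge0 ?(ltW M0)//.
  by rewrite -{1}(GK x); exact: hM.
rewrite ler_pdivrMl ?mulr_gt0 ?exprn_gt0//.
apply: le_trans h5 _; have -> : N * M ^+ 2 * rdot g x = M ^+ 2 * (N * rdot g x) by ring.
by apply: ler_wpM2l => //; exact: sqr_ge0.
Qed.

End InverseOperator.

Section CouplingAsymptotics.
Context {R : realType} {H K : hilbertType R}.
Variables (A : {linear H -> H}) (B : {linear K -> H}) (Gamma : {linear K -> K}).
Hypotheses (A_bounded : bounded_op A) (A_sa : selfadjoint A).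
Hypotheses (B_bounded : bounded_op B) (B_ker : forall x : K, B x = 0 -> x = 0).
Hypotheses (Gamma_bounded : bounded_op Gamma) (Gamma_sa : selfadjoint Gamma).
Hypotheses (Gamma_ge0 : nonnegative_op Gamma) (Gamma_inv : boundedly_invertible Gamma).

Definition coupling (h : H) : H := B (Gamma (adjoint B h)).

(** Linearity of [coupling] rests on the boundedness of [B], through the adjoint, hence an existence
    statement instead of an instance. *)
Lemma coupling_linear : exists V : {linear H -> H}, V =1 coupling.
Proof.
have lin : linear coupling.
  by move=> c x y; rewrite /coupling adjoint_is_linear// !linearP.
pose W := HB.pack_for {linear H -> H} coupling
  (GRing.isLinear.Build _ _ _ _ coupling lin).
by exists W.
Qed.

Variables (V : {linear H -> H}) (VE : V =1 coupling).

Lemma coupling_bounded : bounded_op V.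
Proof.
have [a a0 ha] := bounded_opP B_bounded.
have [g g0 hg] := bounded_opP Gamma_bounded.
have [a' a'0 ha'] := bounded_opP (adjoint_bounded B_bounded).
exists (a * (g * a')) => x; rewrite !rnormE -rmorphM lecR VE /coupling.
apply: le_trans (ha _) _; rewrite -!mulrA ler_wpM2l ?(ltW a0)//.
by apply: le_trans (hg _) _; rewrite ler_wpM2l ?(ltW g0).
Qed.

Lemma coupling_sa : selfadjoint V.
Proof.
move=> x y; rewrite !VE /coupling (adjointP B_bounded) Gamma_sa.
by rewrite -(inner_adjointl B_bounded) .
Qed.

Lemma rdot_coupling x : rdot (V x) x = rdot (Gamma (adjoint B x)) (adjoint B x).
Proof. by rewrite VE /coupling rdot_adjoint. Qed.

Lemma coupling_ge0 x : 0 <= rdot (V x) x.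
Proof. by rewrite rdot_coupling; exact: nonnegative_rdot. Qed.

Variables (z : R[i]) (z_gt0 : 0 < complex.Im z) (x : K).

(** Put [beta = adjoint B r] and [u = x - t Gamma beta] at [t = - i tau]. Then [B u = (A - z) r],
    and the left term is exactly [rdot (inverse Gamma x) x - rdot u (inverse Gamma x)]. Coercivity
    of [Gamma] keeps [tau beta], hence [u], bounded and makes [r] of order [tau^(-1/2)]. Replacing
    [inverse Gamma x] by a nearby [adjoint B h0] turns the last term into [rdot (B u) h0], which
    tends to zero. *)
Lemma coupling_limit (e : R) : 0 < e -> exists2 t0 : R, 0 < t0 &
  forall tau, t0 <= tau ->
    `|tau * complex.Im '[resolvent A V z (0 -i* tau) (B x), B x]
      - rdot (inverse Gamma x) x| <= e.
Proof.
move=> e0.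
have [GK KG] := inverseP Gamma_inv.
have [M M0 hM] := bounded_opP A_bounded.
have [N N0 hN] := bounded_opP Gamma_bounded.
have [c c0 hc] := nonnegative_coercive Gamma_bounded Gamma_sa Gamma_ge0 Gamma_inv.
pose y := complex.Im z; have y0 : 0 < y := z_gt0.
pose Gx := inverse Gamma x.
(* A bound for [u], from [tau * rnorm beta <= rnorm x / c]. *)
pose U := rnorm x + N * (rnorm x / c).
have U0 : 0 <= U.
  apply: addr_ge0; first exact: rnorm_ge0.
  by apply: mulr_ge0; [exact: ltW|apply: divr_ge0; [exact: rnorm_ge0|exact: ltW]].
have U1 : 0 < U + 1 by lra.
have e1 : 0 < e / 2 / (U + 1) by rewrite !divr_gt0.
have [h0 hh0] := adjoint_dense B_bounded B_ker Gx e1.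
pose Q := (M + cmod z) * rnorm h0.
have Q0 : 0 <= Q by rewrite mulr_ge0 ?rnorm_ge0 ?addr_ge0 ?cmod_ge0 ?(ltW M0).
(* Chosen so that [rnorm r ^+ 2 <= X / tau], while [Q] bounds [rdot (B u) h0] through
   [Q * rnorm r]. *)
pose X := rnorm x ^+ 2 / (c * y).
have X0 : 0 <= X.
  by apply: divr_ge0; [exact: sqr_ge0|apply: mulr_ge0; exact: ltW].
(* ensures [Q * sqrt (X / tau) <= e / 2] *)
pose t0 := X * (2 * Q / e) ^+ 2 + 1.
have t00 : 0 < t0 by rewrite ltr_wpDl// mulr_ge0// sqr_ge0.
exists t0 => // tau htau.
have tau0 : 0 < tau by exact: lt_le_trans htau.
pose t : R[i] := 0 -i* tau.
have tl : complex.Im t <= 0 by rewrite /= oppr_le0 ltW.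
pose r := resolvent A V z t (B x).
have rE : pencil A V t z r = B x.
  by apply: resolventK => //; [exact: coupling_bounded|exact: coupling_sa|exact: coupling_ge0].
pose beta := adjoint B r.
have Imr : tau * rdot (Gamma beta) beta + y * rnorm r ^+ 2 <= rnorm beta * rnorm x.
  have : complex.Im '[r, B x] = tau * rdot (Gamma beta) beta + y * rnorm r ^+ 2.
    by rewrite -{1}rE Im_pencil//= ?opprK ?rdot_coupling//; exact: coupling_sa.
  move=> <-; rewrite -(inner_adjointl B_bounded) Im_inner.
  by apply: le_trans (rdot_le _ _) _; rewrite rnormZi.
have b0 := rnorm_ge0 beta; have x0 := rnorm_ge0 x.
have hb : tau * rnorm beta <= rnorm x / c.
  rewrite ler_pdivlMr//.
  have [->|bn] := eqVneq (rnorm beta) 0; first by rewrite mulr0 mul0r.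
  have bp : 0 < rnorm beta by rewrite lt_def bn.
  rewrite -(ler_pM2l bp); apply: le_trans Imr.
  have := ler_wpM2l (ltW tau0) (hc beta).
  have : 0 <= y * rnorm r ^+ 2 by rewrite mulr_ge0 ?(ltW y0)// sqr_ge0.
  nra.
have hr : rnorm r ^+ 2 <= X / tau.
  rewrite ler_pdivlMr// /X ler_pdivlMr ?mulr_gt0//.
  have g0 := nonnegative_rdot Gamma_ge0 beta.
  have h1 : y * rnorm r ^+ 2 <= rnorm beta * rnorm x.
    by apply: le_trans Imr; rewrite lerDr mulr_ge0// ltW.
  have h2 : tau * rnorm beta * c <= rnorm x by rewrite -ler_pdivlMr.
  have h3 : (y * rnorm r ^+ 2) * (tau * c) <= (rnorm beta * rnorm x) * (tau * c).
    by rewrite ler_wpM2r// mulr_ge0 ?(ltW c0) ?(ltW tau0).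
  have h4 := ler_wpM2r x0 h2.
  by rewrite (expr2 (rnorm x)); lra.
pose u := x - t *: Gamma beta.
have hu : rnorm u <= U.
  apply: le_trans (rnormD _ _) _; rewrite rnormN lerD2l rnormZr -/(cmod t).
  rewrite (_ : t = 0 +i* - tau)// cmod_imag normrN gtr0_norm//.
  apply: le_trans (ler_wpM2l (ltW tau0) (hN _)) _.
  by rewrite mulrCA ler_wpM2l ?(ltW N0).
have Bu : B u = A r - z *: r.
  rewrite linearB linearZ /= -[X in X - _]rE /pencil VE /coupling -/beta.
  by rewrite addrAC addrK.
have hBu : rnorm (B u) <= (M + cmod z) * rnorm r.
  by rewrite Bu; apply: le_trans (rnormD _ _) _; rewrite rnormN rnormZr mulrDl lerD2r.
have uE : t *: beta = inverse Gamma (x - u).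
  by rewrite /u opprB addrC subrK -linearZ GK.
have main : tau * complex.Im '[r, B x] = rdot Gx x - rdot u Gx.
  have -> : tau * complex.Im '[r, B x] = rdot (t *: beta) x.
    rewrite /rdot innerZl inner_adjointl//.
    by case: ('[r, B x]) => v w /=; ring.
  have -> : rdot (t *: beta) x = rdot (x - u) Gx by rewrite uE /rdot inverse_sa.
  by rewrite rdotBl (rdotC x).
rewrite -/t -/r main -/Gx addrAC subrr add0r normrN.
have -> : rdot u Gx = rdot u (Gx - adjoint B h0) + rdot (B u) h0.
  by rewrite rdotBr (rdot_adjoint B_bounded) subrK.
apply: le_trans (ler_normD _ _) _; rewrite (splitr e); apply: lerD.
  apply: le_trans (norm_rdot_le _ _) _.
  apply: (@le_trans _ _ ((U + 1) * (e / 2 / (U + 1)))).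
    by apply: ler_pM => //; rewrite ?rnorm_ge0//; lra.
  by rewrite mulrC divfK// gt_eqF.
apply: le_trans (norm_rdot_le _ _) _.
apply: (@le_trans _ _ (Q * rnorm r)).
  by rewrite /Q mulrAC ler_wpM2r ?rnorm_ge0.
have q1 : 0 <= Q * rnorm r by rewrite mulr_ge0// rnorm_ge0.
have e20 : 0 <= e / 2 by rewrite divr_ge0// ltW.
rewrite -ler_sqr ?nnegrE//.
rewrite exprMn; apply: le_trans (ler_wpM2l (sqr_ge0 Q) hr) _.
rewrite mulrA ler_pdivrMr//.
apply: (@le_trans _ _ ((e / 2) ^+ 2 * t0)); last by rewrite ler_wpM2l ?sqr_ge0.
rewrite /t0 mulrDr mulr1.
have -> : (e / 2) ^+ 2 * (X * (2 * Q / e) ^+ 2) = Q ^+ 2 * X.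
  by field; rewrite gt_eqF.
by rewrite lerDl sqr_ge0.
Qed.

End CouplingAsymptotics.

(** * Removal of the Cauchy weights and the average of the resolvent *)

Section CauchyWeights.
Context {R : realType}.

Lemma cauchy_weight_nondecreasing (x s t : R) : 0 < s <= t ->
  s * poisson s x <= t * poisson t x.
Proof.
move=> /andP[s0 st]; have t0 : 0 < t by exact: lt_le_trans st.
rewrite /poisson !mulrA -!expr2.
have p1 : 0 < x ^+ 2 + s ^+ 2 by rewrite ltr_wpDl ?sqr_ge0// exprn_gt0.
have p2 : 0 < x ^+ 2 + t ^+ 2 by rewrite ltr_wpDl ?sqr_ge0// exprn_gt0.
rewrite ler_pdivrMr// mulrAC ler_pdivlMr//.
have : s ^+ 2 <= t ^+ 2 by rewrite ler_sqr ?nnegrE// ltW.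
by have := sqr_ge0 x; nra.
Qed.

Lemma cauchy_weight_compl (x s : R) : 0 < s ->
  1 - s * poisson s x = x ^+ 2 / (x ^+ 2 + s ^+ 2).
Proof.
move=> s0; rewrite /poisson; field.
by rewrite gt_eqF// ltr_wpDl ?sqr_ge0// exprn_gt0.
Qed.

Lemma natSr_cvgy : (n.+1%:R : R) @[n --> \oo] --> +oo.
Proof.
apply/cvgryPge => A; near=> n.
apply: (@le_trans _ _ n%:R); last by rewrite ler_nat.
near: n; exact: nbhs_infty_ger.
Unshelve. all: end_near. Qed.

Lemma cauchy_weight_cvg (x : R) : n.+1%:R * poisson n.+1%:R x @[n --> \oo] --> (1 : R).
Proof.
apply/cvgrPdist_le => e e0; near=> n.
have n0 : 0 < n.+1%:R :> R by [].
have d0 : 0 < x ^+ 2 + n.+1%:R ^+ 2 :> R by rewrite ltr_wpDl ?sqr_ge0// exprn_gt0.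
rewrite cauchy_weight_compl// ger0_norm ?divr_ge0 ?sqr_ge0 ?(ltW d0)// ler_pdivrMr//.
have h : x ^+ 2 <= e * n.+1%:R.
  by rewrite -ler_pdivrMl//; near: n; have /cvgryPge := natSr_cvgy; apply.
apply: le_trans h _; rewrite ler_wpM2l ?(ltW e0)//.
by rewrite ler_wpDl ?sqr_ge0// expr2 ler_peMr// ler1n.
Unshelve. all: end_near. Qed.

(** The weights increase to 1 and the intervals to the line, so one monotone limit removes both. The
    cube couples the cut-off [T = s ^+ 3] to [tau = s]: the error of [poisson_formula], of order
    [tau ^+ 2 / T], vanishes while [T / tau] tends to infinity. *)
Lemma cauchy_weighted_integral (g : R -> R) (L : R) :
  continuous g -> (forall x, 0 <= g x) ->
  \int[lebesgue_measure]_(x in `[- n.+1%:R ^+ 3, n.+1%:R ^+ 3])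
     (n.+1%:R * poisson n.+1%:R x * g x) @[n --> \oo] --> L ->
  (\int[lebesgue_measure]_(x in setT) (g x)%:E = L%:E)%E.
Proof.
move=> cg g0 lim.
pose D n : set R := `[- n.+1%:R ^+ 3, n.+1%:R ^+ 3]%classic.
pose h n x : R := n.+1%:R * poisson n.+1%:R x * g x.
have mD n : measurable (D n) by exact: measurable_itv.
have ch n : continuous (h n).
  move=> x; apply: cvgM; last exact: cg.
  by apply: cvgM; [exact: cvg_cst|exact: poisson_continuous].
have h0 n x : 0 <= h n x by do 2 apply: mulr_ge0 => //; exact: poisson_ge0.
pose f n := (EFin \o h n) \_ (D n).
have mf n : measurable_fun setT (f n).
  apply/(measurable_restrict _ (mD n)) => //.
  apply/measurable_EFinP; apply: measurable_funTS.
  exact: continuous_measurable_fun.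
have f0 n x : setT x -> (0 <= f n x)%E.
  by move=> _; rewrite /f patchE; case: ifP => // _; rewrite lee_fin.
have nd x : setT x -> {homo f ^~ x : n m / (n <= m)%N >-> (n <= m)%E}.
  move=> _ n m nm; rewrite /f !patchE; case: ifPn => [xn|_]; last first.
    by case: ifPn => // _; rewrite lee_fin.
  have nm1 : n.+1%:R <= m.+1%:R :> R by rewrite ler_nat.
  rewrite ifT; last first.
    move: xn; rewrite !inE /D /= !in_itv /= => /andP[x1 x2].
    have nm3 : n.+1%:R ^+ 3 <= m.+1%:R ^+ 3 :> R by rewrite lerXn2r ?nnegrE.
    by apply/andP; split; lra.
  by rewrite /= lee_fin ler_wpM2r// cauchy_weight_nondecreasing// ltr0n.
have lim1 := @cvg_monotone_convergence _ _ R lebesgue_measure setT measurableT f mf f0 nd.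
have fE n : (\int[lebesgue_measure]_(x in setT) f n x)%E =
    (\int[lebesgue_measure]_(x in D n) h n x)%:E.
  rewrite /f -integral_mkcond /= /Rintegral fineK//.
  apply: integrable_fin_num; first exact: mD.
  exact: continuous_itv_integrable.
rewrite (eq_cvg _ _ fE) in lim1.
have <- : (\int[lebesgue_measure]_x limn (f ^~ x) = \int[lebesgue_measure]_x (g x)%:E)%E.
  apply: eq_integral => x _; apply/cvg_lim => //.
  have : EFin (h n x) @[n --> \oo] --> (g x)%:E.
    apply/cvg_EFin; first exact: nearW.
    rewrite -[g x]mul1r; apply: cvgM; last exact: cvg_cst.
    exact: cauchy_weight_cvg.
  apply: cvg_trans; apply: near_eq_cvg; near=> n.
  rewrite /f patchE ifT// inE /D /= in_itv /= -ler_norml.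
  apply: (@le_trans _ _ n.+1%:R).
    near: n; have /cvgryPge := natSr_cvgy; apply.
  by rewrite exprS ler_peMr// exprn_ege1// ler1n.
apply/esym/(cvg_unique _ _ lim1) => //.
by apply/cvg_EFin; [exact: nearW|exact: lim].
Unshelve. all: end_near. Qed.

End CauchyWeights.

Section ResolventAverage.
Context {R : realType} {H K : hilbertType R}.
Variables (A : {linear H -> H}) (B : {linear K -> H}) (Gamma : {linear K -> K}).
Hypotheses (A_bounded : bounded_op A) (A_sa : selfadjoint A).
Hypotheses (B_bounded : bounded_op B) (B_ker : forall x : K, B x = 0 -> x = 0).
Hypotheses (Gamma_bounded : bounded_op Gamma) (Gamma_sa : selfadjoint Gamma).
Hypotheses (Gamma_ge0 : nonnegative_op Gamma) (Gamma_inv : boundedly_invertible Gamma).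
Variables (V : {linear H -> H}) (VE : V =1 coupling B Gamma).
Variables (z : R[i]) (z_gt0 : 0 < complex.Im z) (x : K).

Let V_bounded := coupling_bounded B_bounded Gamma_bounded VE.
Let V_sa := coupling_sa B_bounded Gamma_sa VE.
Let V_ge0 := coupling_ge0 B_bounded Gamma_ge0 VE.

Lemma resolvent_form_continuous b :
  continuous (fun t : R => complex.Im '[resolvent A V z t%:C b, b]).
Proof.
have [C hC] := resolvent_taylor2 A_bounded V_bounded A_sa V_sa V_ge0 z_gt0 b b.
have := taylor2_Im_continuous hC (lexx 0).
by rewrite oppr0.
Qed.

Lemma resolvent_form_ge0 b (t : R) : 0 <= complex.Im '[resolvent A V z t%:C b, b].
Proof.
by rewrite resolvent_Im// mulr_ge0 ?(ltW z_gt0)// sqr_ge0.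
Qed.

Lemma resolvent_average :
  (\int[lebesgue_measure]_(t in setT)
     (complex.Im '[resolvent A V z t%:C (B x), B x])%:E =
   (pi * rdot (inverse Gamma x) x)%:E)%E.
Proof.
apply: cauchy_weighted_integral.
- exact: resolvent_form_continuous.
- exact: resolvent_form_ge0.
set L := rdot _ _.
set I := (X in X @ _ --> _).
pose s (n : nat) : R := n.+1%:R.
pose F n := s n * complex.Im '[resolvent A V z (0 -i* s n) (B x), B x].
pose a := 12 * ((complex.Im z)^-1 * rnorm (B x) ^+ 2).
have a0 : 0 <= a by rewrite mulr_ge0// mulr_ge0 ?sqr_ge0// invr_ge0 ltW.
have s0 n : 0 < s n by rewrite ltr0n.
have Fcvg : F @ \oo --> L.
  apply/cvgrPdist_le => e e0.
  have [t0 t00 ht0] := coupling_limit A_bounded A_sa B_bounded B_ker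
    Gamma_bounded Gamma_sa Gamma_ge0 Gamma_inv VE z_gt0 x e0.
  near=> n; rewrite distrC; apply: ht0.
  near: n; have /cvgryPge := @natSr_cvgy R; apply.
(* Here [s n ^+ 2] is [T / tau]; the factor [pi] of the average is this limit. *)
have atancvg : 2 * atan (s n ^+ 2) @[n --> \oo] --> (pi : R).
  have -> : pi = 2 * (pi / 2) :> R by rewrite mulrC divfK.
  apply: cvgM; first exact: cvg_cst.
  apply: (@cvg_comp _ _ _ (fun n => s n ^+ 2) (@atan R) _ +oo); last exact: cvgy_atan.
  apply/cvgryPge => y; near=> n.
  apply: (@le_trans _ _ (s n)).
    near: n; have /cvgryPge := @natSr_cvgy R; apply.
  by rewrite expr2 ler_peMr ?(ltW (s0 n))// ler1n.
have err n : `|I n - 2 * atan (s n ^+ 2) * F n| <= a * (s n)^-1.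
  have s1 : 1 <= s n by rewrite ler1n.
  have hT : 0 < s n <= s n ^+ 3.
    by rewrite s0 exprS ler_peMr ?(ltW (s0 n))// exprn_ege1.
  have := poisson_formula A_bounded V_bounded A_sa V_sa V_ge0 z_gt0 (B x) hT.
  have -> : s n ^+ 3 / s n = s n ^+ 2 by field; rewrite gt_eqF.
  have -> : 12 * ((complex.Im z)^-1 * rnorm (B x) ^+ 2) * s n ^+ 2 / s n ^+ 3 = a * (s n)^-1.
    by rewrite /a; field; rewrite !gt_eqF.
  rewrite /F (_ : 2 * atan _ * (s n * _) = 2 * s n * atan (s n ^+ 2) *
    complex.Im '[resolvent A V z (0 -i* s n) (B x), B x]); last by ring.
  by [].
have lim0 : I n - 2 * atan (s n ^+ 2) * F n @[n --> \oo] --> (0 : R).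
  apply/cvgrPdist_le => e e0; near=> n; rewrite sub0r normrN.
  apply: le_trans (err n) _; rewrite ler_pdivrMr// mulrC -ler_pdivrMr//.
  near: n; have /cvgryPge := @natSr_cvgy R; apply.
have := cvgD lim0 (cvgM atancvg Fcvg); rewrite add0r.
have -> : (fun n => I n - 2 * atan (s n ^+ 2) * F n) +
    (fun n => 2 * atan (s n ^+ 2)) * F = I.
  by apply/funext => n; rewrite /GRing.add /GRing.mul /= subrK.
by apply.
Unshelve. all: end_near. Qed.

End ResolventAverage.

(** * From Poisson integrals to Borel sets *)

Section Caratheodory.
Context {R : realType}.

Let grid (n : nat) (c : R) : R := (Num.floor (n.+1%:R * c))%:~R / n.+1%:R.

Let grid_cvg (c : R) : grid n c @[n --> \oo] --> c.
Proof.
apply/cvgrPdist_le => e e0; near=> n.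
have n0 : 0 < n.+1%:R :> R by [].
have /andP[h1 h2] := Num.Theory.floor_itv (n.+1%:R * c).
have -> : c - grid n c = (n.+1%:R * c - (Num.floor (n.+1%:R * c))%:~R) / n.+1%:R.
  by rewrite mulrBl mulrAC divff ?mul1r// gt_eqF.
rewrite ger0_norm ?divr_ge0 ?subr_ge0// ler_pdivrMr//.
rewrite intrD in h2.
apply: (@le_trans _ _ 1); first by lra.
rewrite mulrC -ler_pdivrMr// mul1r.
by near: n; have /cvgryPge := @natSr_cvgy R; apply.
Unshelve. all: end_near. Qed.

(* A Caratheodory function is a limit of functions that are constant in the
   second variable on the cells of a grid. *)
Lemma caratheodory_measurable (f : R -> R -> R) :
  (forall c, measurable_fun setT (f ^~ c)) -> (forall t, continuous (f t)) ->
  measurable_fun setT (fun p : R * R => f p.1 p.2).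
Proof.
move=> mf cf.
apply: (@measurable_fun_cvg _ _ _ _ (fun n p => f p.1 (grid n p.2))); last first.
  move=> [t c] _ /=; apply: (@cvg_comp _ _ _ (grid ^~ c) (f t)); first exact: grid_cvg.
  exact: cf.
move=> n _ Y mY; rewrite setTI.
pose cell (k : int) : set R := `[k%:~R / n.+1%:R, (k + 1)%:~R / n.+1%:R[%classic.
have -> : (fun p : R * R => f p.1 (grid n p.2)) @^-1` Y =
    \bigcup_(k in [set: int]) ((f ^~ (k%:~R / n.+1%:R)) @^-1` Y `*` cell k).
  apply/seteqP; split => [[t c] /= h|[t c] [k _] [/= h1]].
    exists (Num.floor (n.+1%:R * c)) => //; split => //=.
    rewrite /cell /= in_itv /= ler_pdivrMr// ltr_pdivlMr// (mulrC c).
    exact: Num.Theory.floor_itv.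
  rewrite /cell /= in_itv /= ler_pdivrMr// ltr_pdivlMr// (mulrC c) => h2.
  by rewrite /grid (Num.Theory.floor_def h2).
apply: countable_bigcupT_measurable => // k.
apply: measurableX; last exact: measurable_itv.
by rewrite -[X in measurable X]setTI; exact: mf.
Unshelve. all: end_near. Qed.

End Caratheodory.

(** * Stieltjes inversion and averaging over the coupling *)

Section PoissonAverage.
Context {R : realType}.
Local Notation leb := (@lebesgue_measure R).
Implicit Types (a b c l t y : R).
Variables (mu : R -> {finite_measure set R -> \bar R}) (p : R -> R -> R -> R) (L : R).
Hypothesis pE : forall y c t, 0 < y ->
  (\int[mu t]_(l in setT) (poisson y (l - c))%:E = (p y c t)%:E)%E.
Hypothesis p_measurable : forall y c, 0 < y -> measurable_fun setT (p y c).
Hypothesis p_continuous : forall y t, 0 < y -> continuous (fun c => p y c t).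
Hypothesis p_average : forall y c, 0 < y ->
  (\int[leb]_(t in setT) (p y c t)%:E = (pi * L)%:E)%E.

(** The angle under which the segment from [a] to [b] is seen from [l + i y]: the integral of the
    Poisson kernel over the segment. *)
Definition arc (y a b l : R) : R := atan ((b - l) / y) - atan ((a - l) / y).

Lemma p_ge0 y c t : 0 < y -> 0 <= p y c t.
Proof.
move=> y0; rewrite -lee_fin -pE//.
by apply: integral_ge0 => l _; rewrite lee_fin poisson_ge0.
Qed.

Lemma arc_ge0 y a b l : 0 < y -> a < b -> 0 <= arc y a b l.
Proof.
move=> y0 ab; rewrite subr_ge0; apply: le_atan.
by rewrite ler_pM2r ?invr_gt0// lerB// ltW.
Qed.

Let ind (a b c : R) : R := \1_(`[a, b]%classic) c.

Let ind_measurable a b : measurable_fun setT (ind a b).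
Proof. exact: measurable_indic. Qed.

Let ind_ge0 a b c : 0 <= ind a b c.
Proof. by rewrite /ind indicE. Qed.

Lemma arc_integral y a b l : 0 < y -> a < b ->
  (\int[leb]_(c in setT) (ind a b c * poisson y (l - c))%:E = (arc y a b l)%:E)%E.
Proof.
move=> y0 ab.
have -> : (\int[leb]_(c in setT) (ind a b c * poisson y (l - c))%:E =
    \int[leb]_(c in `[a, b]%classic) (poisson y (c - l))%:E)%E.
  rewrite [RHS]integral_mkcond; apply: eq_integral => c _.
  rewrite patchE /ind indicE; case: ifP => _; rewrite ?mul0r// mul1r.
  by rewrite /poisson -sqrrN opprB.
rewrite /arc -(Rintegral_poisson l y0 ab) /Rintegral fineK//.
apply: integrable_fin_num; first exact: measurable_itv.
apply: continuous_itv_integrable => x.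
apply: (@continuous_comp _ _ _ (fun x => x - l) (poisson y)); last exact: poisson_continuous.
by apply: cvgB; [exact: cvg_id|exact: cvg_cst].
Qed.

Lemma arc_mu y a b t : 0 < y -> a < b ->
  (\int[mu t]_(l in setT) (arc y a b l)%:E =
   \int[leb]_(c in setT) (ind a b c * p y c t)%:E)%E.
Proof.
move=> y0 ab.
pose f (q : R * R) : \bar R := (ind a b q.2 * poisson y (q.1 - q.2))%:E.
have mf : measurable_fun setT f.
  apply/measurable_EFinP; apply: measurable_funM.
    exact: (measurableT_comp (ind_measurable a b) measurable_snd).
  have mpy : measurable_fun setT (poisson y).
    by apply: continuous_measurable_fun; exact: poisson_continuous.
  apply: (measurableT_comp mpy).
  by apply: measurable_funB; [exact: measurable_fst|exact: measurable_snd].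
have f0 q : (0 <= f q)%E by rewrite lee_fin mulr_ge0// poisson_ge0.
have := @fubini_tonelli _ _ _ _ R (mu t) leb f mf f0.
rewrite /f /=; under eq_integral do rewrite arc_integral//.
move=> ->; apply: eq_integral => c _.
under eq_integral do rewrite EFinM.
rewrite ge0_integralZl_EFin//.
- by rewrite pE// -EFinM.
- by move=> l _; rewrite lee_fin poisson_ge0.
- apply/measurable_EFinP; apply: continuous_measurable_fun => l.
  apply: (@continuous_comp _ _ _ (fun x => x - c) (poisson y)); last exact: poisson_continuous.
  by apply: cvgB; [exact: cvg_id|exact: cvg_cst].
Qed.

Let g y a b (q : R * R) : \bar R := (ind a b q.2 * p y q.2 q.1)%:E.

Let g_measurable y a b : 0 < y -> measurable_fun setT (g y a b).
Proof.
move=> y0; apply/measurable_EFinP; apply: measurable_funM.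
  exact: (measurableT_comp (ind_measurable a b) measurable_snd).
apply: (@caratheodory_measurable R (fun t c => p y c t)) => [c|t].
  exact: p_measurable.
exact: p_continuous.
Qed.

Let g_ge0 y a b q : 0 < y -> (0 <= g y a b q)%E.
Proof. by move=> y0; rewrite lee_fin mulr_ge0// p_ge0. Qed.

(** Nothing is known about the dependence of [mu t] on [t] except through [p], so measurability is
    read off from the joint measurability of [p]. *)
Lemma arc_mu_measurable y a b : 0 < y -> a < b ->
  measurable_fun setT (fun t => \int[mu t]_(l in setT) (arc y a b l)%:E)%E.
Proof.
move=> y0 ab; under eq_fun do rewrite arc_mu//.
exact: (@measurable_fun_fubini_tonelli_F _ _ _ _ R leb (g y a b)
  (g_measurable a b y0) (fun q => g_ge0 a b q y0)).
Qed.

Lemma arc_average y a b : 0 < y -> a < b ->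
  (\int[leb]_(t in setT) \int[mu t]_(l in setT) (arc y a b l)%:E =
   (pi * L * (b - a))%:E)%E.
Proof.
move=> y0 ab; under eq_integral do rewrite arc_mu//.
have := @fubini_tonelli _ _ _ _ R leb leb (g y a b)
  (g_measurable a b y0) (fun q => g_ge0 a b q y0).
rewrite /g /= => ->.
transitivity (\int[leb]_c ((pi * L) * ind a b c)%:E)%E.
  apply: eq_integral => c _; under eq_integral do rewrite EFinM.
  rewrite ge0_integralZl_EFin//.
  - by rewrite p_average// -EFinM mulrC.
  - by move=> t _; rewrite lee_fin p_ge0.
  - by apply/measurable_EFinP; exact: p_measurable.
have L0 : 0 <= pi * L.
  by rewrite -lee_fin -(p_average 0 ltr01); apply: integral_ge0 => t _; rewrite lee_fin p_ge0.
under eq_integral do rewrite EFinM.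
rewrite ge0_integralZl_EFin//.
- rewrite /ind integral_indic//.
  have e : lebesgue_measure (`[a, b]%classic : set R) = (b - a)%:E.
    by rewrite lebesgue_measure_itv /= lte_fin ab -EFinB.
  by rewrite setIT (EFinM (pi * L)); congr (_ * _)%E.
- by move=> c _; rewrite lee_fin.
- by apply/measurable_EFinP; exact: ind_measurable.
Qed.

(** A majorant independent of [y]. For [l] within [2 D] of [a0] the angle is at most [pi], which
    gives the first part of the constant. Farther away, the distance from [l] to the segment is at
    least half that to [a0], so the kernel is at most [4 / X ^+ 2]; with [X ^+ 2 + 1 <= 2 X ^+ 2]
    this gives [8 D]. *)
Lemma arc_le y a b a0 D l : 0 < y <= 1 -> a < b -> a0 <= a -> b <= a0 + D ->
  1 <= D -> arc y a b l <= (pi * (1 + 4 * D ^+ 2) + 8 * D) * poisson 1 (l - a0).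
Proof.
move=> /andP[y0 y1] ab a0a bD D1.
have pi0 : 0 <= pi :> R by exact: pi_ge0.
set X := l - a0.
have X1 : 0 < X ^+ 2 + 1 by rewrite ltr_wpDl ?sqr_ge0.
have -> : poisson 1 X = (X ^+ 2 + 1)^-1 by rewrite /poisson expr1n mul1r.
rewrite ler_pdivlMr//.
have [X2D|X2D] := leP `|X| (2 * D).
  have arcpi : arc y a b l <= pi.
    have := atan_ltpi2 ((b - l) / y); have := atan_gtNpi2 ((a - l) / y).
    by rewrite /arc; lra.
  have X4 : X ^+ 2 <= 4 * D ^+ 2.
    by rewrite -real_normK ?num_real//; have := normr_ge0 X; nra.
  have := ler_pM (arc_ge0 l y0 ab) (ltW X1) arcpi (_ : X ^+ 2 + 1 <= 1 + 4 * D ^+ 2).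
  by move=> /(_ _)/le_trans; apply; [rewrite addrC lerD2l|rewrite lerDl; lra].
have X4 : 4 * D ^+ 2 <= X ^+ 2.
  by rewrite -[X ^+ 2]real_normK ?num_real//; nra.
have Xp : 0 < X ^+ 2 by apply: lt_le_trans X4; rewrite mulr_gt0// exprn_gt0//; lra.
have bnd : arc y a b l <= 4 / X ^+ 2 * (b - a).
  rewrite /arc -(Rintegral_poisson l y0 ab); apply: le_trans (ler_norm _) _.
  apply: Rintegral_itv_norm_le; first exact: ltW.
    move=> x.
    apply: (@continuous_comp _ _ _ (fun x => x - l) (poisson y)); last exact: poisson_continuous.
    by apply: cvgB; [exact: cvg_id|exact: cvg_cst].
  move=> c /andP[ac cb]; rewrite ger0_norm ?poisson_ge0//.
  have hc : X ^+ 2 <= 4 * (c - l) ^+ 2.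
    have -> : (c - l) ^+ 2 = (X - (c - a0)) ^+ 2 by rewrite /X; ring.
    have : 0 <= c - a0 <= D by apply/andP; split; lra.
    move=> /andP[]; move: (c - a0) => v v0 vD.
    move: X2D; have [X0|X0] := leP 0 X.
      by rewrite ger0_norm// => h; nra.
    by rewrite ltr0_norm// => h; nra.
  rewrite /poisson ler_pdivrMr ?ltr_wpDl ?sqr_ge0 ?exprn_gt0//.
  rewrite mulrAC ler_pdivlMr//.
  by have := sqr_ge0 y; nra.
have Dba : b - a <= D by lra.
have h4 : 4 / X ^+ 2 * (b - a) <= 4 / X ^+ 2 * D.
  by rewrite ler_wpM2l// divr_ge0// ltW.
have h5 : X ^+ 2 + 1 <= 2 * X ^+ 2 by nra.
apply: (@le_trans _ _ (4 / X ^+ 2 * D * (2 * X ^+ 2))).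
  by apply: ler_pM (ltW X1) _ h5; [exact: arc_ge0|exact: le_trans h4].
have -> : 4 / X ^+ 2 * D * (2 * X ^+ 2) = 8 * D by field; rewrite -sqrf_eq0 gt_eqF.
by rewrite lerDr mulr_ge0//; nra.
Qed.

Let N (n : nat) : R := n.+1%:R.
(** The shift [(N n)^-1] dominates the height [(N n ^+ 2)^-1]. At the endpoints the limit is
    therefore 0 or [pi] instead of [pi / 2], and [k] tends everywhere to [pi] times the indicator of
    the half-open interval; point masses need no separate treatment. *)
Let k a b n := arc (N n ^+ 2)^-1 (a + (N n)^-1) (b + (N n)^-1).

Let N_gt0 n : 0 < N n. Proof. by rewrite ltr0n. Qed.

Let atan_step (v : R) : atan (N n * (N n * v + 1)) @[n --> \oo] -->
  (if 0 <= v then pi / 2 else - (pi / 2) : R).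
Proof.
have Ncvg : N @ \oo --> +oo := @natSr_cvgy R.
case: leP => v0.
  apply: (@cvg_comp _ _ _ (fun n => N n * (N n * v + 1)) (@atan R) _ +oo); last exact: cvgy_atan.
  apply/cvgryPge => y; near=> n.
  apply: (@le_trans _ _ (N n)); first by near: n; have /cvgryPge := Ncvg; apply.
  by rewrite ler_peMr ?(ltW (N_gt0 n))// lerDr mulr_ge0 ?(ltW (N_gt0 n)).
rewrite (_ : (fun n => _) = (fun n => - atan (- (N n * (N n * v + 1))))); last first.
  by apply/funext => n; rewrite atanN opprK.
apply: cvgN.
apply: (@cvg_comp _ _ _ (fun n => - (N n * (N n * v + 1))) (@atan R) _ +oo); last exact: cvgy_atan.
apply/cvgryPge => y; near=> n.
apply: (@le_trans _ _ (N n)); first by near: n; have /cvgryPge := Ncvg; apply.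
rewrite -mulrN ler_peMr ?(ltW (N_gt0 n))// opprD -mulrN -lerBlDr opprK.
rewrite -ler_pdivrMr ?oppr_gt0//.
by near: n; have /cvgryPge := Ncvg; apply.
Unshelve. all: end_near. Qed.

Let k_cvg a b l : a < b ->
  k a b n l @[n --> \oo] --> (pi * \1_(`]a, b]%classic) l : R).
Proof.
move=> ab.
have kE n : k a b n l = atan (N n * (N n * (b - l) + 1)) - atan (N n * (N n * (a - l) + 1)).
  by rewrite /k /arc; congr (atan _ - atan _); field; rewrite gt_eqF.
rewrite (eq_cvg _ _ kE).
have -> : (pi * \1_(`]a, b]%classic) l : R) = (if 0 <= b - l then pi / 2 else - (pi / 2)) -
    (if 0 <= a - l then pi / 2 else - (pi / 2)).
  rewrite indicE mem_setE in_itv /= !subr_ge0.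
  have [la|al] := leP l a => /=.
    by rewrite (le_trans la (ltW ab)) mulr0 subrr.
  case: leP => lb /=; last by rewrite mulr0 subrr.
  by rewrite mulr1 opprK -splitr.
by apply: cvgB; exact: atan_step.
Qed.

Let k_cond a b n : a < b ->
  [/\ 0 < (N n ^+ 2)^-1 <= 1, a + (N n)^-1 < b + (N n)^-1, a <= a + (N n)^-1,
      b + (N n)^-1 <= a + (b - a + 1) & 1 <= b - a + 1].
Proof.
move=> ab; have N1 : 1 <= N n by rewrite ler1n.
have i0 : 0 < (N n)^-1 by rewrite invr_gt0.
have i1 : (N n)^-1 <= 1 by rewrite invf_le1.
split; [|by move: i0 i1; move: (N n)^-1 => i; lra..].
by rewrite invr_gt0 exprn_gt0// invf_le1 ?exprn_gt0// exprn_ege1.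
Qed.

(** The constant of [arc_le] for [D = b - a + 1], where the 1 absorbs the shift of the endpoints. *)
Let C a b : R := pi * (1 + 4 * (b - a + 1) ^+ 2) + 8 * (b - a + 1).

Let C_ge0 a b : a < b -> 0 <= C a b.
Proof.
move=> ab; have s0 := sqr_ge0 (b - a + 1).
have s1 : 0 <= 1 + 4 * (b - a + 1) ^+ 2 by lra.
by have := mulr_ge0 (pi_ge0 R) s1; rewrite /C; lra.
Qed.

Let k_bound a b n l : a < b -> 0 <= k a b n l <= C a b * poisson 1 (l - a).
Proof.
move=> ab; have [h1 h2 h3 h4 h5] := k_cond n ab; have /andP[y0 _] := h1.
by rewrite arc_ge0//=; exact: arc_le.
Qed.

Let k_measurable a b n : measurable_fun setT (k a b n).
Proof.
apply: continuous_measurable_fun => l; apply: cvgB.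
  apply: (@continuous_comp _ _ _ (fun l => (b + (N n)^-1 - l) / (N n ^+ 2)^-1) (@atan R)).
    apply: cvgM; last exact: cvg_cst.
    by apply: cvgB; [exact: cvg_cst|exact: cvg_id].
  exact: continuous_atan.
apply: (@continuous_comp _ _ _ (fun l => (a + (N n)^-1 - l) / (N n ^+ 2)^-1) (@atan R)).
  apply: cvgM; last exact: cvg_cst.
  by apply: cvgB; [exact: cvg_cst|exact: cvg_id].
exact: continuous_atan.
Qed.

Let poisson_measurable a : measurable_fun setT (fun l : R => poisson 1 (l - a)).
Proof.
apply: continuous_measurable_fun => l.
apply: (@continuous_comp _ _ _ (fun x => x - a) (poisson 1)); last exact: poisson_continuous.
by apply: cvgB; [exact: cvg_id|exact: cvg_cst].
Qed.

Let Cp_integral a b t : a < b ->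
  (\int[mu t]_(l in setT) (C a b * poisson 1 (l - a))%:E = (C a b * p 1 a t)%:E)%E.
Proof.
move=> ab; under eq_integral do rewrite EFinM.
rewrite ge0_integralZl_EFin ?C_ge0//.
- by rewrite pE// -EFinM.
- by move=> l _; rewrite lee_fin poisson_ge0.
- by apply/measurable_EFinP; exact: poisson_measurable.
Qed.

Let k_mu_cvg a b t : a < b ->
  (\int[mu t]_(l in setT) (k a b n l)%:E @[n --> \oo] --> pi%:E * mu t `]a, b]%classic)%E.
Proof.
move=> ab.
have -> : (pi%:E * mu t `]a, b]%classic)%E =
    (\int[mu t]_l (pi * \1_(`]a, b]%classic) l)%:E)%E.
  under eq_integral do rewrite EFinM.
  rewrite ge0_integralZl_EFin ?pi_ge0//.
  - by rewrite integral_indic// setIT.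
  - by apply/measurable_EFinP; exact: measurable_indic.
have [] := @dominated_convergence _ _ R (mu t) setT measurableT
  (fun n l => (k a b n l)%:E) (fun l => (pi * \1_(`]a, b]%classic) l)%:E)
  (fun l => (C a b * poisson 1 (l - a))%:E) => //.
- by move=> n; apply/measurable_EFinP; exact: k_measurable.
- apply/measurable_EFinP; apply: measurable_funM; first exact: measurable_cst.
  exact: measurable_indic.
- apply: aeW => l _; apply/cvg_EFin; first exact: nearW.
  exact: k_cvg.
- apply/integrableP; split.
    apply/measurable_EFinP; apply: measurable_funM; first exact: measurable_cst.
    exact: poisson_measurable.
  under eq_integral => l _.
    rewrite gee0_abs; last by rewrite lee_fin mulr_ge0 ?C_ge0 ?poisson_ge0.
    over.
  by rewrite Cp_integral// ltry.
- apply: aeW => l n _; have /andP[k0 k1] := k_bound n l ab.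
  by rewrite gee0_abs ?lee_fin.
Qed.

Let dominated a b t n : a < b ->
  (`|\int[mu t]_(l in setT) (k a b n l)%:E| <= (C a b * p 1 a t)%:E)%E.
Proof.
move=> ab.
have k01 l : (0 <= (k a b n l)%:E <= (C a b * poisson 1 (l - a))%:E)%E.
  by have /andP[k0 k1] := k_bound n l ab; rewrite !lee_fin k0.
rewrite gee0_abs; last by apply: integral_ge0 => l _; have /andP[] := k01 l.
rewrite -Cp_integral//; apply: ge0_le_integral => //.
- by move=> l _; have /andP[] := k01 l.
- by apply/measurable_EFinP; exact: k_measurable.
- apply/measurable_EFinP; apply: measurable_funM; first exact: measurable_cst.
  exact: poisson_measurable.
- by move=> l _; have /andP[] := k01 l.
Qed.

Let mu_ocitv_measurable a b : a < b ->
  measurable_fun setT (fun t => mu t `]a, b]%classic).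
Proof.
move=> ab.
have -> : (fun t => mu t `]a, b]%classic) =
    (fun t => (pi^-1)%:E * (pi%:E * mu t `]a, b]%classic))%E.
  by apply/funext => t; rewrite muleA -EFinM mulVf ?mul1e// gt_eqF// pi_gt0.
apply: measurable_funeM.
apply: (emeasurable_fun_cvg (fun n t => \int[mu t]_(l in setT) (k a b n l)%:E)%E).
  move=> n; have [/andP[h1 _] h2 _ _ _] := k_cond n ab.
  exact: arc_mu_measurable.
by move=> t _; exact: k_mu_cvg.
Qed.

Let mu_ocitv_average a b : a < b ->
  (\int[leb]_(t in setT) mu t `]a, b]%classic = (L * (b - a))%:E)%E.
Proof.
move=> ab.
have mk n : measurable_fun setT (fun t => \int[mu t]_(l in setT) (k a b n l)%:E)%E.
  have [/andP[h1 _] h2 _ _ _] := k_cond n ab.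
  exact: arc_mu_measurable.
have [] := @dominated_convergence _ _ R leb setT measurableT
  (fun n t => \int[mu t]_(l in setT) (k a b n l)%:E)%E
  (fun t => pi%:E * mu t `]a, b]%classic)%E
  (fun t => (C a b * p 1 a t)%:E) => //.
- by apply: measurable_funeM; exact: mu_ocitv_measurable.
- by apply: aeW => t _; exact: k_mu_cvg.
- have mC : measurable_fun setT (fun t => C a b * p 1 a t).
    by apply: measurable_funM; [exact: measurable_cst|exact: p_measurable].
  apply/integrableP; split; first exact/measurable_EFinP.
  under eq_integral => t _.
    rewrite gee0_abs; last by rewrite lee_fin mulr_ge0 ?C_ge0 ?p_ge0.
    rewrite EFinM; over.
  rewrite ge0_integralZl_EFin ?C_ge0//.
  + by rewrite p_average// -EFinM ltry.
  + by move=> t _; rewrite lee_fin p_ge0.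
  + by apply/measurable_EFinP; exact: p_measurable.
- by apply: aeW => t n _; exact: dominated.
move=> _ _ lim.
have e : (\int[leb]_(t in setT) (pi%:E * mu t `]a, b]%classic) = (pi * L * (b - a))%:E)%E.
  apply/esym/(cvg_unique _ _ lim) => //.
  (* Shifting both endpoints preserves the length, so the averages do not depend on [n]. *)
  have <- : (fun=> (pi * L * (b - a))%:E) =
      (fun n => \int[leb]_(t in setT) \int[mu t]_(l in setT) (k a b n l)%:E)%E.
    apply/funext => n; have [/andP[h1 _] h2 _ _ _] := k_cond n ab.
    rewrite arc_average//; congr (_ * _)%:E.
    by rewrite opprD addrACA subrr addr0.
  exact: cvg_cst.
rewrite ge0_integralZl_EFin ?pi_ge0// in e; last exact: mu_ocitv_measurable.
have := congr1 (fun z => (pi^-1)%:E * z)%E e.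
have pi0 : pi != 0 :> R by rewrite gt_eqF// pi_gt0.
by rewrite muleA -!EFinM -mulrA !mulKf// mulVf// mul1e.
Qed.

Variable m : R.
Hypothesis mu_mass : forall t, mu t setT = m%:E.

(** Half-open intervals are stable under intersection and generate the Borel sets. The total mass
    [m] is independent of [t], so complements only require subtraction from a constant. *)
Lemma averaged_measurable S : measurable S -> measurable_fun setT (fun t => mu t S).
Proof.
move=> mS.
apply: (@dynkin_induction _ _ (@ocitv R) (fun S => measurable_fun setT (fun t => mu t S))).
- by [].
- exact: ocitvI.
- by rewrite (_ : (fun _ => _) = cst m%:E)//; apply/funext => t; exact: mu_mass.
- move=> _ /ocitvP[->|[[a b] /= ab ->]]; last exact: mu_ocitv_measurable.
  by rewrite (_ : (fun _ => _) = cst 0%E)//; apply/funext => t; rewrite measure0.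
- move=> A mA hA.
  rewrite (_ : (fun _ => _) = (fun t => m%:E - mu t A)%E).
    by apply: emeasurable_funB => //; exact: measurable_cst.
  apply/funext => t; rewrite -setTD measureD// ?setTI.
    by congr (_ - _)%E; exact: mu_mass.
  by rewrite [ltLHS](mu_mass t) ltry.
- move=> F mF tF hF.
  rewrite (_ : (fun _ => _) = (fun t => \sum_(n <oo) mu t (F n))%E).
    exact: ge0_emeasurable_sum.
  by apply/funext => t; rewrite measure_bigcup//; apply: eq_eseriesl => n; rewrite in_setT.
- exact: mS.
Qed.

Definition averaged (S : set (measurableTypeR R)) : \bar R := (\int[leb]_(t in setT) mu t S)%E.

Let averaged0 : averaged set0 = 0%E.
Proof. by rewrite /averaged integral0_eq. Qed.

Let averaged_ge0 S : (0 <= averaged S)%E.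
Proof. exact: integral_ge0. Qed.

Let averaged_sigma_additive : semi_sigma_additive averaged.
Proof.
move=> F mF tF mUF.
have -> : averaged (\bigcup_n F n) = (\sum_(n <oo) averaged (F n))%E.
  rewrite /averaged -integral_nneseries//.
    apply: eq_integral => t _; rewrite (@measure_bigcup _ _ _ (mu t) setT F)//.
      by congr (limn _); apply/funext => n; apply: eq_bigl => i; rewrite in_setT.
    by move=> i _; exact: mF.
  by move=> n; exact: (averaged_measurable (mF n)).
by apply: is_cvg_nneseries => n _ _; exact: averaged_ge0.
Qed.

HB.instance Definition _ := isMeasure.Build _ (measurableTypeR R) _ averaged
  averaged0 averaged_ge0 averaged_sigma_additive.

(** Two measures that agree on half-open intervals, finite on the intervals from [- n] to [n],
    coincide; nonnegativity of [L] makes the scaled Lebesgue measure a measure. *)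
Lemma averaged_lebesgue S : 0 <= L -> measurable S -> averaged S = (leb S * L%:E)%E.
Proof.
move=> L0 mS.
rewrite muleC.
have := @measure_unique _ R (measurableTypeR R) (@ocitv R) (fun n => `](- n%:R), n%:R]%classic)
  erefl (@ocitvI R) (fun n => is_ocitv _ _) _ (mscale (NngNum L0) leb) averaged.
rewrite /mscale /= => h; apply/esym/h => //.
- apply/seteqP; split => // x _; exists (Num.truncn `|x|).+1 => //=.
  rewrite in_itv /=; have := truncnS_gt `|x|.
  have : `|x| < (Num.truncn `|x|).+1%:R by exact: truncnS_gt.
  by rewrite ltr_norml => /andP[-> /ltW ->].
- move=> _ /ocitvP[->|[[a b] /= ab ->]]; first by rewrite !measure0.
  rewrite [RHS](mu_ocitv_average ab) /mscale /= mulrC EFinM muleC; congr (_ * _)%E.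
  by rewrite lebesgue_measure_itv /= lte_fin ab -EFinB.
- move=> n; rewrite /mscale /= lebesgue_measure_itv /=.
  case: ifP => _; last by rewrite mule0.
  by rewrite -EFinB -EFinM ltry.
Qed.

End PoissonAverage.

(** Supplies the finite measure structure that Tonelli's theorem for [mu t] requires, whereas
    [spectral_measure] provides a bare measure. *)
Lemma finite_measureP d (T : measurableType d) (R : realType)
    (mu : {measure set T -> \bar R}) : (mu setT < +oo)%E ->
  exists nu : {finite_measure set T -> \bar R}, forall S, nu S = mu S.
Proof.
move=> mu_fin; exists (mfrestr measurableT mu_fin) => S.
by rewrite /= /mfrestr /mrestr setIT.
Qed.

(** * Scalar spectral measures of the perturbed operators *)

Section SpectralAverage.
Context {R : realType} {H K : hilbertType R}.
Variables (A : {linear H -> H}) (B : {linear K -> H}) (Gamma : {linear K -> K}).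
Hypotheses (A_bounded : bounded_op A) (A_sa : selfadjoint A).
Hypotheses (B_bounded : bounded_op B) (Gamma_bounded : bounded_op Gamma).
Hypotheses (Gamma_sa : selfadjoint Gamma) (Gamma_ge0 : nonnegative_op Gamma).
Variables (V : {linear H -> H}) (VE : V =1 coupling B Gamma).

Let V_bounded := coupling_bounded B_bounded Gamma_bounded VE.
Let V_sa := coupling_sa B_bounded Gamma_sa VE.
Let V_ge0 := coupling_ge0 B_bounded Gamma_ge0 VE.

(** The first resolvent identity, in the spectral parameter, gives a Lipschitz bound along a
    horizontal line. *)
Lemma resolvent_form_spectral_continuous (y t : R) b : 0 < y ->
  continuous (fun c : R => complex.Im '[resolvent A V (c +i* y) t%:C b, b]).
Proof.
move=> y0; apply: (@lipschitz_continuous _ _ (y^-1 * (y^-1 * rnorm b) * rnorm b)).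
move=> c c'; pose z := c +i* y; pose w := c' +i* y.
have tl : complex.Im t%:C <= 0 by [].
have z0 : 0 < complex.Im z by [].
have w0 : 0 < complex.Im w by [].
pose rw := resolvent A V w t%:C b.
have -> : resolvent A V z t%:C b = rw + (z - w) *: resolvent A V z t%:C rw.
  apply: resolvent_uniq => //.
  rewrite linearD linearZ/= resolventK// (pencil_shift_spectral A V t%:C z w).
  by rewrite resolventK// -addrA -scalerDl addrA subrK subrr scale0r addr0.
rewrite -raddfB -linearBl /= -/rw addrAC subrr add0r.
apply: le_trans (norm_Im_le _) _; rewrite innerZl cmodM mulrC.
have -> : cmod (z - w) = `|c - c'|.
  by rewrite -cmod_real; congr cmod; apply/eqP; rewrite eq_complex /= subrr !eqxx.
rewrite ler_wpM2r//; apply: le_trans (norm_inner_le _ _) _.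
rewrite ler_wpM2r ?rnorm_ge0//.
have i0 : 0 <= y^-1 by rewrite invr_ge0 ltW.
apply: le_trans (rnorm_resolvent A_bounded V_bounded A_sa V_sa V_ge0 z0 _ tl) _.
rewrite ler_wpM2l//.
exact: (rnorm_resolvent A_bounded V_bounded A_sa V_sa V_ge0 w0 _ tl).
Qed.

Lemma perturbationE t h : perturbation A B Gamma t h = A h + t%:C *: V h.
Proof. by rewrite VE. Qed.

Lemma perturbation_linear t : linear (perturbation A B Gamma t).
Proof.
move=> c x y; rewrite !perturbationE (linearP A) (linearP V) !scalerDr !scalerA.
by rewrite (mulrC t%:C) addrACA.
Qed.

Lemma perturbation_sa t : selfadjoint (perturbation A B Gamma t).
Proof.
move=> x y; rewrite !perturbationE linearDl linearDr /= !innerZl !innerZr.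
by rewrite conjc_real A_sa V_sa.
Qed.

(** Multiplying [spectral_resolvent] by [y] turns its integrand into the Poisson kernel and, by
    [resolvent_Im], the squared norm into the imaginary part of the resolvent form. *)
Lemma scalar_spectral_measure (t : R) (E : set R -> {linear H -> H}) (b : H) :
  spectral_measure (perturbation A B Gamma t) E ->
  exists nu : {finite_measure set R -> \bar R},
    (forall S, measurable S -> nu S = (complex.Re '[E S b, b])%:E) /\
    forall y c, 0 < y -> (\int[nu]_(l in setT) (poisson y (l - c))%:E =
      (complex.Im '[resolvent A V (c +i* y) t%:C b, b])%:E)%E.
Proof.
move=> [E_pvm [M E_M] E_int].
have [mu muP] := choice E_int.
have muE x S : measurable S -> mu x S = (complex.Re '[E S x, x])%:E.
  by have [+ _] := muP x; apply.
have TE x : '[perturbation A B Gamma t x, x] = (\int[mu x]_(l in setT) l)%:C.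
  by have [] := muP x.
have b_fin : (mu b setT < +oo)%E by rewrite muE// ltry.
have [nu nuE] := finite_measureP b_fin.
exists nu; split=> [S mS|y c y0]; first by rewrite nuE muE.
have z0 : 0 < complex.Im (c +i* y) by [].
have tl : complex.Im t%:C <= 0 by [].
set r := resolvent A V (c +i* y) t%:C b.
have rb : perturbation A B Gamma t r - (c +i* y) *: r = b.
  rewrite perturbationE.
  exact: (resolventK A_bounded V_bounded A_sa V_sa V_ge0 z0 b tl).
have := spectral_resolvent (perturbation_linear t) (perturbation_sa t)
  E_pvm E_M muE TE y0 rb.
rewrite (resolvent_Im A_bounded V_bounded A_sa V_sa V_ge0 z0)//= -/r => intE.
rewrite (eq_measure_integral (mu b)); last by move=> S _ _; exact: nuE.
under eq_integral do rewrite EFinM.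
rewrite ge0_integralZl_EFin ?(ltW y0)//.
- by rewrite [X in (_ * X)%E]intE -EFinM.
- by move=> l _; rewrite lee_fin invr_ge0 addr_ge0 ?sqr_ge0.
apply/measurable_EFinP; apply: continuous_measurable_fun => l; apply: cvgV.
  by rewrite gt_eqF// ltr_wpDl ?sqr_ge0// exprn_gt0.
apply: cvgD; last exact: cvg_cst.
by apply: cvgM; (apply: cvgB; [exact: cvg_id|exact: cvg_cst]).
Qed.

End SpectralAverage.

Theorem theorem1p7 (R : realType) (H K : hilbertType R)
    (sepH : separable H) (sepK : separable K)
    (A : {linear H -> H}) (A_bounded : bounded_op A) (A_sa : selfadjoint A)
    (B : {linear K -> H}) (B_bounded : bounded_op B)
    (B_ker : forall x : K, B x = 0 -> x = 0)
    (Gamma : {linear K -> K}) (Gamma_bounded : bounded_op Gamma)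
    (Gamma_sa : selfadjoint Gamma) (Gamma_ge0 : nonnegative_op Gamma)
    (Gamma_inv : boundedly_invertible Gamma)
    (E : R -> set R -> {linear H -> H})
    (E_spec : forall t : R, spectral_measure (perturbation A B Gamma t) (E t))
    (S : set R) (S_borel : measurable S) (x : K) :
  measurable_fun setT
    (fun t : R => complex.Re '[adjoint B (E t S (B x)), x]) /\
  (\int[lebesgue_measure]_(t in setT)
      (complex.Re '[adjoint B (E t S (B x)), x])%:E =
   lebesgue_measure S * (complex.Re '[inverse Gamma x, x])%:E)%E.
Proof.
have [V VE] := coupling_linear Gamma B_bounded.
have nuP (t : R) := scalar_spectral_measure A_bounded A_sa B_bounded Gamma_bounded
  Gamma_sa Gamma_ge0 VE (B x) (E_spec t).
have [nu {}nuP] := choice nuP.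
pose p (y c t : R) := complex.Im '[resolvent A V (c +i* y) t%:C (B x), B x].
have pE y c t : 0 < y ->
    (\int[nu t]_(l in setT) (poisson y (l - c))%:E = (p y c t)%:E)%E.
  by move=> y0; have [_] := nuP t; apply.
have p_measurable (y c : R) : 0 < y -> measurable_fun setT (p y c).
  move=> y0; apply: continuous_measurable_fun.
  exact: (resolvent_form_continuous A_bounded A_sa B_bounded Gamma_bounded
    Gamma_sa Gamma_ge0 VE (z := c +i* y)).
have p_continuous (y t : R) : 0 < y -> continuous (fun c => p y c t).
  move=> y0; exact: (resolvent_form_spectral_continuous A_bounded A_sa B_bounded
    Gamma_bounded Gamma_sa Gamma_ge0 VE).
pose L := rdot (inverse Gamma x) x.
have p_average (y c : R) : 0 < y ->
    (\int[lebesgue_measure]_(t in setT) (p y c t)%:E = (pi * L)%:E)%E.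
  move=> y0; exact: (resolvent_average A_bounded A_sa B_bounded B_ker
    Gamma_bounded Gamma_sa Gamma_ge0 Gamma_inv VE (z := c +i* y)).
have nu_mass t : nu t setT = (rnorm (B x) ^+ 2)%:E.
  have [-> // _] := nuP t; have [E_pvm _ _] := E_spec t.
  by rewrite (pvm_setT E_pvm) -rdotxx.
have nuE t : nu t S = (complex.Re '[adjoint B (E t S (B x)), x])%:E.
  by have [-> // _] := nuP t; rewrite inner_adjointl.
have L0 : 0 <= L.
  have [_ KG] := inverseP Gamma_inv.
  (* Writing the second [x] as [Gamma (inverse Gamma x)] exhibits [L] as the form of [Gamma] at
     [inverse Gamma x]. *)
  by rewrite /L -[X in rdot _ X]KG rdotC; exact: nonnegative_rdot.
split.
  apply/measurable_EFinP; rewrite (_ : _ \o _ = fun t => nu t S).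
    exact: (averaged_measurable pE p_measurable p_continuous nu_mass S_borel).
  by apply/funext => t; rewrite nuE.
have := averaged_lebesgue pE p_measurable p_continuous p_average nu_mass L0 S_borel.
by rewrite /averaged => <-; apply: eq_integral => t _; rewrite nuE.
Qed.
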